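(* Let $n\ge 2$ and let $A\in\mathbb{C}^{n\times n}$ have symmetrized principal minors (equivalently, symmetrized cycle-sums), and write $c_k=c_k(A)$, $d_k=d_k(A)$ for its order-$k$ cycle-sums and principal minors. (1) If $A$ is symmetric, then $A$ is conjugate to $\lambda\mathbb{1}_n+\mu I_n$ for some $\lambda,\mu\in\mathbb{C}$. Moreover, for all $\lambda,\mu\in\mathbb{C}$, $$d_k(\lambda\mathbb{1}_n+\mu I_n)=\mu^{k-1}(\mu+k\lambda)\quad(1\le k\le n),\qquad c_k(\lambda\mathbb{1}_n+\mu I_n)=(k-1)!\,\lambda^k\quad(2\le k\le n).$$ (2) If $A$ is skew-symmetric, then there is $\lambda\in\mathbb{C}$ such that $A$ is conjugate to $\lambda\mathbb{1}_n^{\wedge}$, or (for $n=4$ only) to $$\lambda\begin{pmatrix}0&1&1&1\\-1&0&1&-1\\-1&-1&0&1\\-1&1&-1&0\end{pmatrix}.$$ Moreover, for every even $k$ with $2\le k\le n$, $d_k(\mathbb{1}_n^{\wedge})=1$ and $c_k(\mathbb{1}_n^{\wedge})=(-1)^{k/2}E_{k-1}$, where $E_m$ denotes the $m$-th Euler number. (3) For general $A$: (a) If $n\ge 3$ and $c_1=c_2=0$, then one of the following holds: (i) $A$ is conjugate to a strictly upper triangular matrix, and $c_1=c_2=\cdots=c_n=0$; (ii) $A$ is conjugate to a weighted $n$-cycle matrix, and $c_1=\cdots=c_{n-1}=0$, $c_n\neq0$. (b) If $c_2\ne0$ and $c_1=c_3=0$ (so $n\geq 3$), then $A$ is conjugate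 to a skew-symmetric matrix with symmetrized principal minors. (c) If $c_1=0$ and $c_2c_3\ne0$ (so $n\ge3$), then $A$ is conjugate to $\lambda T_n(x)$ for some $\lambda\in\mathbb{C}$ and $x\in\mathbb{C}^*$ satisfying $\lambda^2=-c_2$ and $\lambda^3\left(x-\frac1x\right)=c_3$. Moreover, for $x\in\mathbb{C}^*$ and $2\le s\le n$, $$c_s(T_n(x))=x^{-s}E_{s-1}(-x^2),$$ where $E_m(t)$ is the $m$-th Eulerian polynomial, and $$d_s(T_n(x))=\frac{(x^2)^{s-1}+(-1)^s}{x^{s-2}(x^2+1)}\quad\text{if }x^2\neq-1,$$ so that $(x^2+1)\,d_s(x\,T_n(x))=x^{2s}+(-1)^sx^2$.
   Context: For $A=(a_{i,j})\in\mathbb{C}^{n\times n}$ and $I\subseteq[n]=\{1,\dots,n\}$, let $D_I(A)$ be the principal minor of $A$ with row and column set $I$ ($D_\emptyset=1$), and define the cycle-sum $$C_I(A)=\sum_{\{i_1,\dots,i_k\}=I,\ i_1=\min I}a_{i_1,i_2}a_{i_2,i_3}\cdots a_{i_{k-1},i_k}a_{i_k,i_1},$$ the sum being over all orderings $(i_2,\dots,i_k)$ of $I\setminus\{\min I\}$ ($C_\emptyset=1$). $A$ has symmetrized principal minors if $D_I(A)=D_J(A)$ whenever $|I|=|J|$; the common value for $|I|=k$ is denoted $d_k(A)$. $A$ has symmetrized cycle-sums if $C_I(A)=C_J(A)$ whenever $|I|=|J|$; the common value for $|I|=k$ is denoted $c_k(A)$. These two properties are equivalent. ''Conjugate'' means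 conjugate by an element of the group of $n\times n$ matrices generated by the permutation matrices and the invertible diagonal matrices. $\mathbb{1}_n$ is the $n\times n$ all-ones matrix; $\mathbb{1}_n^{\wedge}$ is the $n\times n$ skew-symmetric matrix with all entries above the diagonal equal to $1$. $T_n(x)$, for $x\in\mathbb{C}^*$, is the $n\times n$ matrix with zero diagonal whose $(i,j)$ entry for $i\ne j$ is $\mathrm{sgn}(j-i)\,x^{\,j-i-\mathrm{sgn}(j-i)}$. A weighted $n$-cycle matrix is the product of an invertible diagonal matrix and the permutation matrix of a permutation of $[n]$ that is an $n$-cycle. The Euler number $E_m$ is the number of alternating permutations of $[m]$ (i.e. $\sum_{m\ge0}E_m x^m/m!=\tan x+\sec x$). The Eulerian polynomial is $E_m(t)=\sum_{w\in\mathfrak{S}_m}t^{\mathrm{des}(w)+1}$ for $m\geq 1$, where $\mathrm{des}(w)$ is the number of $i$ with $w(i)>w(i+1)$. *)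

(* Defs.v *)
From HB Require Import structures.
From mathcomp Require Import all_boot all_order all_fingroup all_algebra.
From mathcomp Require Import reals.
From mathcomp Require Import complex.

Set Implicit Arguments.
Unset Strict Implicit.
Unset Printing Implicit Defensive.

Import Order.TTheory GRing.Theory Num.Theory.

Local Open Scope ring_scope.

Section PrincipalMinorsAndCycleSums.
Variables (F : fieldType) (n : nat).
Implicit Types (A : 'M[F]_n) (I : {set 'I_n}).

Definition principal_minor A I : F :=
  \det (mxsub (@enum_val _ (mem I)) (@enum_val _ (mem I)) A).

(* a_{i_1,i_2} ... a_{i_{k-1},i_k} a_{i_k,i_1} for the ordering i_1 :: s *)
Definition cycle_prod A (i1 : 'I_n) (s : seq 'I_n) : F :=
  \prod_(p <- zip (i1 :: s) (rcons s i1)) A p.1 p.2.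

(* [enum I] is increasing, so its head is min I and its tail enumerates
   the other elements of I. *)
Definition cycle_sum A I : F :=
  if enum I is i1 :: s then \sum_(t <- permutations s) cycle_prod A i1 t
  else 1.

Definition symmetrized_minors A :=
  forall I J : {set 'I_n}, #|I| = #|J| ->
    principal_minor A I = principal_minor A J.

Definition symmetrized_cycle_sums A :=
  forall I J : {set 'I_n}, #|I| = #|J| -> cycle_sum A I = cycle_sum A J.

(* The common values d_k(A) and c_k(A) are read off on I = {1, ..., k}; they
   are meaningful only for k <= n and when A has the corresponding
   symmetrization property. *)
Definition minor_of_order A (k : nat) : F :=
  principal_minor A [set i : 'I_n | (i < k)%N].

Definition cycle_sum_of_order A (k : nat) : F :=
  cycle_sum A [set i : 'I_n | (i < k)%N].

(* The subgroup of GL_n generated by the permutation matrices and the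
   invertible diagonal matrices. *)
Inductive perm_diag_group : 'M[F]_n -> Prop :=
| pdg_perm (s : 'S_n) : perm_diag_group (perm_mx s)
| pdg_diag (d : 'rV[F]_n) : diag_mx d \in unitmx -> perm_diag_group (diag_mx d)
| pdg_mul (P Q : 'M[F]_n) :
    perm_diag_group P -> perm_diag_group Q -> perm_diag_group (P *m Q)
| pdg_inv (P : 'M[F]_n) : perm_diag_group P -> perm_diag_group (invmx P).

Definition conjugate_mx A (B : 'M[F]_n) :=
  exists2 P : 'M[F]_n, perm_diag_group P & A = P *m B *m invmx P.

Definition symmetric_mx A := A^T = A.

Definition skew_symmetric_mx A := A^T = - A.

Definition strictly_upper_triangular A :=
  forall i j : 'I_n, (j <= i)%N -> A i j = 0.

Definition weighted_cycle_mx A :=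
  exists (d : 'rV[F]_n) (s : 'S_n),
    [/\ diag_mx d \in unitmx,
        forall i : 'I_n, porbit s i = [set: 'I_n] &
        A = diag_mx d *m perm_mx s].

End PrincipalMinorsAndCycleSums.

Section SpecialMatrices.
Variables (F : fieldType) (n : nat).

Definition ones_mx : 'M[F]_n := const_mx 1.

Definition skew_ones_mx : 'M[F]_n :=
  \matrix_(i < n, j < n)
    if (i < j)%N then 1 else if (j < i)%N then - 1 else 0.

Definition T_mx (x : F) : 'M[F]_n :=
  \matrix_(i < n, j < n)
    if i == j then 0
    else let e : int := j%:Z - i%:Z in (sgz e)%:~R * x ^ (e - sgz e).

(* Only meant for n = 4; a generic size avoids a cast along n = 4. *)
Definition skew_exceptional_mx : 'M[F]_n :=
  \matrix_(i < n, j < n)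
    nth 0 (nth [::] [:: [::   0;   1;   1;   1];
                        [:: - 1;   0;   1; - 1];
                        [:: - 1; - 1;   0;   1];
                        [:: - 1;   1; - 1;   0]] i) j.

End SpecialMatrices.

Arguments ones_mx {F} n.
Arguments skew_ones_mx {F} n.
Arguments skew_exceptional_mx {F} n.

(* w(1) > w(2) < w(3) > ... ; indices in 'S_m start at 0. *)
Definition alternating_perm (m : nat) (w : 'S_m) : bool :=
  [forall i : 'I_m, forall j : 'I_m,
    (j == i.+1 :> nat) ==> ((w j < w i)%N == ~~ odd i)].

Definition euler_number (m : nat) : nat :=
  #|[set w : 'S_m | alternating_perm w]|.

Definition des (m : nat) (w : 'S_m) : nat :=
  #|[set i : 'I_m | [exists j : 'I_m, (j == i.+1 :> nat) && (w j < w i)%N]]|.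

Definition eulerian_poly (F : fieldType) (m : nat) : {poly F} :=
  \sum_(w : 'S_m) 'X^((des w).+1).

Arguments eulerian_poly {F} m.

(* Main.v *)
Require Import Defs.
From HB Require Import structures.
From mathcomp Require Import all_boot all_order all_fingroup all_algebra.
From mathcomp Require Import reals.
From mathcomp Require Import complex.
From mathcomp Require Import ring zify.

(* Opening the permutations of I at the cycle through min I gives
   D_I = sum over B in I \ min I of (-1)^|B| C_(min I u B) D_(I \ min I \ B),
   so minors and cycle-sums of sets of equal size determine each other.

   The model matrices are diagonally conjugate to band matrices, with constants
   c on, a above and b below the diagonal.  Their minors depend only on the size
   and satisfy a linear recurrence; a cycle product of theirs depends only on the
   number of descents of the cycle, hence the Eulerian polynomials.  The Euler
   numbers satisfy the recursion which the minors 1, 0, 1, 0, ... of the skew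
   all-ones matrix impose on its cycle-sums.

   Conversely let c_1, c_2, c_3 be given with c_2 != 0, and let a b = c_2 and
   c_2 (a + b) = c_3.  After a diagonal conjugation the first row is a, the first
   column is b, and the 3-cycles through the first index force every other pair
   of opposite entries to be {a, b}.  For a = b this is a band matrix; otherwise
   it is a tournament, conjugate to a band matrix as soon as it is transitive.
   A cyclic triangle is excluded by c_3 when a + b != 0, and by c_4 in the
   skew case, except for n = 4.  When c_1 = c_2 = 0, a shortest cycle of
   the support digraph is chordless, so its cycle-sum is nonzero, and it must
   pass through all indices. *)

Set Implicit Arguments.
Unset Strict Implicit.
Unset Printing Implicit Defensive.

Import Order.TTheory GRing.Theory Num.Theory.

Local Open Scope ring_scope.

(** * Principal minors and cycle-sums *)

Section SumsOverOrderings.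
Variables (T : finType) (V : nmodType).
Implicit Types (S B : {set T}) (f : seq T -> V).

Definition ord_sum S f : V := \sum_(p <- permutations (enum S)) f p.

Lemma sum_permutations_perm_eq (s t : seq T) f :
  perm_eq s t ->
  \sum_(p <- permutations s) f p = \sum_(p <- permutations t) f p.
Proof. by move=> est; apply/perm_big/perm_permutations. Qed.

Lemma ord_sum0 f : ord_sum set0 f = f [::].
Proof.
rewrite /ord_sum enum_set0.
by rewrite (perm_big [:: [::] : seq T]) ?big_seq1.

Qed.

Lemma perm_rem_enum S x : perm_eq (rem x (enum S)) (enum (S :\ x)).
Proof.
apply: uniq_perm => [||y]; rewrite ?rem_uniq ?enum_uniq //.
by rewrite mem_rem_uniq ?enum_uniq // !inE !mem_enum !inE.
Qed.

Lemma ord_sum_rec S f : S != set0 ->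
  ord_sum S f = \sum_(j in S) ord_sum (S :\ j) (fun p => f (j :: p)).
Proof.
move=> Sn0; rewrite /ord_sum.
have sz: (0 < size (enum S))%N by rewrite -cardE card_gt0.
rewrite (perm_big _ (permutationsE sz)) /= undup_id ?enum_uniq //.
rewrite big_allpairs_dep big_enum; apply: eq_bigr => j jS.
by apply: sum_permutations_perm_eq; exact: perm_rem_enum.
Qed.

Lemma ord_sum1 x f : ord_sum [set x] f = f [:: x].
Proof.
rewrite ord_sum_rec; last by apply/set0Pn; exists x; rewrite inE.
by rewrite big_set1 setDv ord_sum0.
Qed.

Lemma ord_sum2 x y f : x != y ->
  ord_sum [set x; y] f = f [:: x; y] + f [:: y; x].
Proof.
move=> xy; rewrite ord_sum_rec; last by apply/set0Pn; exists x; rewrite !inE eqxx.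
rewrite big_setU1 ?inE //= big_set1.
have -> : [set x; y] :\ x = [set y].
  by apply/setP => z; rewrite !inE; case: eqP => //= ->; rewrite (negPf xy).
have -> : [set x; y] :\ y = [set x].
  apply/setP => z; rewrite !inE; case: eqP => //= [->|]; last by rewrite orbF.
  by rewrite eq_sym (negPf xy).
by rewrite !ord_sum1.
Qed.

Lemma ord_sum3 x y z f : x != y -> y != z -> x != z ->
  ord_sum [set x; y; z] f =
  f [:: x; y; z] + f [:: x; z; y] + (f [:: y; x; z] + f [:: y; z; x])
  + (f [:: z; x; y] + f [:: z; y; x]).
Proof.
move=> xy yz xz; rewrite ord_sum_rec; last first.
  by apply/set0Pn; exists x; rewrite !inE eqxx.
rewrite -setUA big_setU1 ?inE ?negb_or ?xy ?xz //= big_setU1 ?inE //= big_set1.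
rewrite addrA.
have -> : (x |: [set y; z]) :\ x = [set y; z].
  apply/setP => t; rewrite !inE; case: eqP => //= ->.
  by rewrite (negPf xy) (negPf xz).
have -> : (x |: [set y; z]) :\ y = [set x; z].
  apply/setP => t; rewrite !inE; case: (t =P y) => //= ->.
  by rewrite eq_sym (negPf xy) (negPf yz).
have -> : (x |: [set y; z]) :\ z = [set x; y].
  apply/setP => t; rewrite !inE; case: (t =P z) => //= [->|]; last by rewrite orbF.
  by rewrite eq_sym (negPf xz) eq_sym (negPf yz).
by rewrite !ord_sum2.
Qed.

Lemma eq_ord_sum S f g :
  (forall p, perm_eq p (enum S) -> f p = g p) -> ord_sum S f = ord_sum S g.
Proof.
move=> fg; apply: eq_big_seq => p; rewrite mem_permutations; exact: fg.
Qed.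

(** Choosing a nonempty [B] with a marked element [j] amounts to choosing [j] first and then
    [B :\ j]. This matches a first-letter recursion with a sum over subsets. *)
Lemma sum_subsets_rec S (g : T -> {set T} -> V) :
  \sum_(B : {set T} | (B \subset S) && (B != set0)) \sum_(j in B) g j (B :\ j) =
  \sum_(j in S) \sum_(B : {set T} | B \subset S :\ j) g j B.
Proof.
rewrite (exchange_big_dep (mem S)) /=; last first.
  by move=> B j /andP[/subsetP BS _]; exact: BS.
apply: eq_bigr => j jS.
rewrite [LHS](reindex_onto (fun B => j |: B) (fun B => B :\ j)) /=; last first.
  by move=> B /andP[_ jB]; rewrite setD1K.
apply: eq_big => [B|B /andP[_ /eqP->]//].
apply/andP/idP => [[/andP[/andP[BS _] _] /eqP <-]|BS].
  by rewrite setSD.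
have jB : j \notin B by apply/negP => /(subsetP BS); rewrite !inE eqxx.
rewrite setU1K // subUset sub1set jS (subset_trans BS (subD1set _ _)) /= eqxx.
by rewrite setU11 andbT; split=> //; apply/set0Pn; exists j; rewrite setU11.
Qed.

Lemma split_subset0 S (g : {set T} -> V) :
  \sum_(B : {set T} | B \subset S) g B =
  g set0 + \sum_(B : {set T} | (B \subset S) && (B != set0)) g B.
Proof. by rewrite (bigD1 set0) ?sub0set. Qed.

Lemma sum_subsets_card S (h : nat -> V) :
  \sum_(B : {set T} | B \subset S) h #|B| =
  \sum_(b < #|S|.+1) h b *+ 'C(#|S|, b).
Proof.
rewrite (partition_big (fun B : {set T} => inord #|B| : 'I_(#|S|).+1) xpredT) //=.
apply: eq_bigr => b _.
rewrite -(cards_draws S b) -sumr_const; apply: eq_big => [B|B].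
  rewrite inE; case BS: (B \subset S) => //=.
  by rewrite -val_eqE /= inordK // ltnS subset_leq_card.
by move=> /andP[BS /eqP <-]; rewrite inordK // ltnS subset_leq_card.
Qed.

End SumsOverOrderings.

Section Concatenation.
Variables (T : finType) (V : nmodType).

(** An ordering of [S] with a cut point is a subset [B] with an ordering of [B] and one of its
    complement. The induction removes the first letter; the cut before it accounts for the empty
    [B]. *)
Lemma ord_sum_cat (S : {set T}) (f : seq T -> seq T -> V) :
  ord_sum S (fun p => \sum_(i < (size p).+1) f (take i p) (drop i p)) =
  \sum_(B : {set T} | B \subset S)
     ord_sum B (fun L => ord_sum (S :\: B) (fun R => f L R)).
Proof.
have [k] := ubnP #|S|; elim: k => // k IH in S f *; rewrite ltnS => leSk.
rewrite split_subset0 ord_sum0 setD0.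
have [->|Sn0] := eqVneq S set0.
  rewrite !ord_sum0 big_ord_recl big_ord0 /= big_pred0 // => B.
  by rewrite subset0; case: eqP.
rewrite {1}/ord_sum.
under eq_bigr do rewrite big_ord_recl /= take0 drop0.
rewrite big_split /=; congr (_ + _).
transitivity (\sum_(B : {set T} | (B \subset S) && (B != set0)) \sum_(j in B)
   ord_sum (B :\ j) (fun L => ord_sum (S :\ j :\: (B :\ j)) (f (j :: L)))).
  rewrite (sum_subsets_rec S (fun j B =>
     ord_sum B (fun L => ord_sum (S :\ j :\: B) (f (j :: L))))).
  rewrite -[LHS]/(ord_sum _ _) ord_sum_rec //; apply: eq_bigr => j jS.
  rewrite -(IH (S :\ j) (fun L R => f (j :: L) R)) //.
  by move: leSk; rewrite (cardsD1 j) jS.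
apply: eq_bigr => B /andP[BS Bn0]; rewrite [RHS]ord_sum_rec //.
apply: eq_bigr => j jB.
have -> // : S :\ j :\: (B :\ j) = S :\: B.
apply/setP => x; rewrite !inE; case: eqP => //= ->; by rewrite jB.
Qed.

End Concatenation.

(** Sylvester's identity: the block matrices [M] and [U], multiplied in either order, give a block
    triangular product, and [U] has determinant 1. *)
Lemma det_1D_mulmxC (R : comNzRingType) (m n : nat)
    (X : 'M[R]_(m, n)) (Y : 'M[R]_(n, m)) :
  \det (1%:M + X *m Y) = \det (1%:M + Y *m X).
Proof.
pose M := block_mx 1%:M (- Y) X 1%:M.
pose U := block_mx 1%:M Y 0 1%:M.
have detU : \det U = 1 by rewrite det_ublock !det1 mulr1.
have <- : \det (M *m U) = \det (1%:M + X *m Y).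
  rewrite mulmx_block !mulmx1 !mul1mx !mulmx0 !addr0 subrr.
  by rewrite det_lblock det1 mul1r addrC.
have <- : \det (U *m M) = \det (1%:M + Y *m X).
  rewrite mulmx_block !mulmx1 !mul1mx !mul0mx !add0r addNr.
  by rewrite det_lblock det1 mulr1.
by rewrite !det_mulmx mulrC.
Qed.

Lemma enum_set_sorted n (I : {set 'I_n}) :
  sorted (fun x y : 'I_n => (x < y)%N) (enum I).
Proof.
rewrite {1}/enum_mem; apply: sorted_filter => [y x z|]; first exact: ltn_trans.
by rewrite -enumT; have := iota_ltn_sorted 0 n; rewrite -val_enum_ord sorted_map.
Qed.

(** * Expansion of a principal minor along the cycle through an index *)

Section CycleExpansion.
Variables (F : fieldType) (n : nat) (A : 'M[F]_n).
Implicit Types (S B : {set 'I_n}) (u v j : 'I_n).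

(** The Leibniz formula over permutations of all indices supported in [S]; unlike a minor of size
    [#|S|], it needs no renumbering when [S] loses elements. *)
Definition perm_det S : F :=
  \sum_(s : 'S_n | perm_on S s) (-1) ^+ s * \prod_(x in S) A x (s x).

(** Sylvester's identity turns the minor into the determinant of an n by n matrix [N] that agrees
    with [A] on [S] and with the identity elsewhere. Only permutations supported in [S] then
    contribute. *)
Lemma principal_minorE S : principal_minor A S = perm_det S.
Proof.
pose f := @enum_val _ (mem S); pose A' := mxsub f f A.
(* [E] is the matrix that selects the rows indexed by [S]. *)
pose E : 'M[F]_(#|S|, n) := \matrix_(i, x) (f i == x)%:R.
have EEt : E *m E^T = 1%:M.
  apply/matrixP => i j; rewrite !mxE (bigD1 (f i)) //= !mxE eqxx mul1r big1.
    by rewrite addr0 eq_sym (inj_eq enum_val_inj).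
  by move=> x; rewrite !mxE eq_sym => /negPf->; rewrite mul0r.
have -> : principal_minor A S = \det (1%:M + (A' - 1%:M) *m E *m E^T).
  by rewrite -mulmxA EEt mulmx1 addrC subrK.
rewrite det_1D_mulmxC; set N := 1%:M + _.
have f_inj : injective f by exact: enum_val_inj.
have NE x y : N x y = if (x \in S) && (y \in S) then A x y else (x == y)%:R.
  rewrite mxE [X in X + _]mxE [X in _ + X]mxE.
  under eq_bigr do rewrite !mxE.
  case xS: (x \in S); last first.
    rewrite big1 ?addr0 // => i _.
    case: eqP => [fx|]; last by rewrite mul0r.
    by move: xS; rewrite -fx enum_valP.
  have fx : f (enum_rank_in xS x) = x by rewrite /f enum_rankK_in.
  rewrite (bigD1 (enum_rank_in xS x)) //= fx eqxx mul1r.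
  rewrite [X in _ + (_ + X)]big1 ?addr0; last first.
    move=> i; rewrite -(inj_eq f_inj) fx => /negPf->.
    by rewrite mul0r.
  case yS: (y \in S); last first.
    rewrite big1 ?addr0 // => i _; rewrite !mxE.
    case: (f i =P y) => [fy|]; last by rewrite mulr0.
    by move: yS; rewrite -fy enum_valP.
  have fy : f (enum_rank_in yS y) = y by rewrite /f enum_rankK_in.
  rewrite (bigD1 (enum_rank_in yS y)) //= !mxE fy eqxx mulr1.
  rewrite [X in _ + (_ + X)]big1 ?addr0; last first.
    move=> i; rewrite -(inj_eq f_inj) fy !mxE => /negPf->.
    by rewrite mulr0.
  rewrite -(inj_eq f_inj) fy fx.
  by rewrite addrC subrK.
rewrite /determinant (bigID (perm_on S)) /= [X in _ + X]big1 ?addr0.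
  apply: eq_bigr => s sS; congr (_ * _).
  rewrite (bigID (mem S)) /= [X in _ * X]big1 ?mulr1.
    by apply: eq_bigr => x xS; rewrite NE xS perm_closed // xS.
  by move=> x xS; rewrite NE (negPf xS) (out_perm sS) ?eqxx.
move=> s /subsetPn[x]; rewrite inE => sx xS.
by rewrite (bigD1 x) //= NE (negPf xS) eq_sym (negPf sx) mul0r mulr0.
Qed.

Definition path_prod u v (p : seq 'I_n) : F :=
  \prod_(q <- zip (u :: p) (rcons p v)) A q.1 q.2.

(** Cycle-sums need only [u = v]; the ends are kept apart because the first-step recursion moves the
    start alone. *)
Definition path_sum u v S : F := ord_sum S (path_prod u v).

Lemma path_prod_nil u v : path_prod u v [::] = A u v.
Proof. by rewrite /path_prod big_seq1. Qed.

Lemma path_prod_cons u v j p :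
  path_prod u v (j :: p) = A u j * path_prod j v p.
Proof. by rewrite /path_prod /= big_cons. Qed.

Lemma path_sum0 u v : path_sum u v set0 = A u v.
Proof. by rewrite /path_sum ord_sum0 path_prod_nil. Qed.

Lemma path_sum_rec u v S : S != set0 ->
  path_sum u v S = \sum_(j in S) A u j * path_sum j v (S :\ j).
Proof.
move=> Sn0; rewrite /path_sum ord_sum_rec //; apply: eq_bigr => j _.
by rewrite /ord_sum big_distrr; apply: eq_bigr => p _; rewrite path_prod_cons.
Qed.

(* The determinant of the matrix with row set [u |: S] and the same column
   set, except that column [v] of [A] stands in for column [u]. *)
Definition open_det u v S : F :=
  \sum_(s : 'S_n | perm_on (u |: S) s)
     (-1) ^+ s * \prod_(x in u |: S) A x (if s x == u then v else s x).

Lemma open_detuu u S : open_det u u S = perm_det (u |: S).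
Proof.
apply: eq_bigr => s _; congr (_ * _); apply: eq_bigr => x _.
by case: eqP => [->|].
Qed.

(** The permutations are sorted by the image of [u]. Those fixing [u] give the product; those
    sending [u] to [j] in [S] leave the same problem with start [j], at the cost of a sign. *)
Lemma open_det_rec u v S : u \notin S ->
  open_det u v S =
  A u v * perm_det S - \sum_(j in S) A u j * open_det j v (S :\ j).
Proof.
move=> uS; rewrite /open_det (partition_big (fun s : 'S_n => s u) (mem (u |: S)))
  /=; last by move=> s us; rewrite perm_closed // setU11.
have fixu (s : 'S_n) : perm_on (u |: S) s && (s u == u) = perm_on S s.
  apply/andP/idP => [[us /eqP su]|sS].
    apply/subsetP => x; rewrite inE => sx.
    have := subsetP us x; rewrite !inE => /(_ sx) /orP[/eqP xu|//].
    by rewrite xu su eqxx in sx.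
  split; last by rewrite (out_perm sS uS).
  apply: (subset_trans sS).
    exact: subsetUr.
rewrite big_setU1 //=; congr (_ + _).
  rewrite /perm_det big_distrr; apply: eq_big => // s; rewrite fixu => sS.
  rewrite big_setU1 //= (out_perm sS uS) eqxx mulrCA; congr (_ * (_ * _)).
  apply: eq_bigr => x xS; case: eqP => // sxu.
  by move: uS; rewrite -sxu perm_closed // xS.
rewrite -sumrN; apply: eq_bigr => j jS.
have uj : u != j by apply: contraNneq uS => ->.
(* Composing with the transposition of [u] and [j] makes the permutation fix [u], and the arc that
   returned to [u] now returns to [j]. *)
rewrite (reindex_inj (mulIg (tperm u j))) /= big_distrr -sumrN /=.
rewrite setD1K //; apply: eq_big => [s|s /andP[_ /eqP]].
  rewrite -fixu permM; congr (_ && _); last first.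
    by rewrite (can2_eq (tpermK _ _) (tpermK _ _)) tpermR.
  have tS : perm_on (u |: S) (tperm u j).
    apply: (subset_trans (tperm_on u j)).
    by rewrite subUset !sub1set setU11 inE jS orbT.
  apply/idP/idP => H; last exact: perm_onM.
  by rewrite -[s](mulgK (tperm u j)) tpermV perm_onM.
rewrite permM => /(canRL (tpermK u j)); rewrite tpermR => suu.
rewrite odd_permM odd_tperm uj signr_addb expr1 mulrN1 !mulNr; congr (- _).
rewrite mulrCA; congr (_ * _).
rewrite big_setU1 //= permM suu tpermL eq_sym (negPf uj); congr (_ * _).
apply: eq_bigr => x xS; rewrite permM.
have sxu : s x != u.
  by rewrite -[X in _ != X]suu (inj_eq perm_inj); apply: contraNneq uS => <-.
case: (tpermP u j (s x)) => [/eqP||/eqP sx].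
- by rewrite (negPf sxu).
- by move=> ->; rewrite !eqxx.
by move=> /eqP sj; rewrite (negPf sxu) (negPf sj).
Qed.

(** Iterating [open_det_rec] follows the path from [u] until it closes at [v]; [B] collects the
    intermediate vertices, each of which has contributed a sign. *)
Lemma open_det_expand u v S : u \notin S ->
  open_det u v S = \sum_(B : {set 'I_n} | B \subset S)
     (-1) ^+ #|B| * path_sum u v B * perm_det (S :\: B).
Proof.
have [k] := ubnP #|S|; elim: k => // k IH in u S *; rewrite ltnS => leSk uS.
rewrite open_det_rec // split_subset0 cards0 mul1r path_sum0 setD0.
congr (_ + _); rewrite -sumrN.
transitivity (\sum_(j in S) \sum_(B : {set 'I_n} | B \subset S :\ j)
    - (A u j * ((-1) ^+ #|B| * path_sum j v B * perm_det (S :\ j :\: B)))).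
  apply: eq_bigr => j jS; rewrite IH ?big_distrr /= ?sumrN //.
    by move: leSk; rewrite (cardsD1 j) jS.
  by rewrite !inE eqxx.
rewrite -(sum_subsets_rec S (fun j B =>
  - (A u j * ((-1) ^+ #|B| * path_sum j v B * perm_det (S :\ j :\: B))))).
apply: eq_bigr => B /andP[BS Bn0]; rewrite path_sum_rec // -mulrA mulr_suml mulr_sumr.
apply: eq_bigr => j jB /=.
have -> : S :\ j :\: (B :\ j) = S :\: B.
  by apply/setP => x; rewrite !inE; case: eqP => //= ->; rewrite jB.
by rewrite [in RHS](cardsD1 j B) jB exprS; ring.
Qed.

Lemma perm_det_expand u S : u \notin S ->
  perm_det (u |: S) = \sum_(B : {set 'I_n} | B \subset S)
     (-1) ^+ #|B| * path_sum u u B * perm_det (S :\: B).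
Proof. by move=> uS; rewrite -open_detuu open_det_expand. Qed.

Lemma enum_setU1_min u S : (forall x, x \in S -> (u < x)%N) ->
  enum (u |: S) = u :: enum S.
Proof.
move=> uS; have lt_trans : transitive (fun x y : 'I_n => (x < y)%N).
  by move=> y x z; apply: ltn_trans.
apply: (irr_sorted_eq lt_trans) => //.
- by move=> x; rewrite /= ltnn.
- exact: enum_set_sorted.
- rewrite /= (path_min_sorted _) ?enum_set_sorted //.
  by apply/allP => x; rewrite mem_enum => /uS.
- by move=> x; rewrite !(inE, mem_enum).
Qed.

Lemma cycle_sumU1 u S : (forall x, x \in S -> (u < x)%N) ->
  cycle_sum A (u |: S) = path_sum u u S.
Proof. by move=> uS; rewrite /cycle_sum enum_setU1_min. Qed.

Lemma cycle_sum_set0 : cycle_sum A set0 = 1.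
Proof. by rewrite /cycle_sum enum_set0. Qed.

Lemma principal_minor_set0 : principal_minor A set0 = 1.
Proof.
rewrite principal_minorE /perm_det (big_pred1 1%g) => [|s].
  by rewrite odd_perm1 big_set0 mulr1.
apply/idP/eqP => [s0|->]; last exact: perm_on1.
by apply: (perm_on_id s0); rewrite cards0.
Qed.

Lemma set_minP (I : {set 'I_n}) : I != set0 ->
  {u & {S : {set 'I_n} | I = u |: S & forall x, x \in S -> (u < x)%N}}.
Proof.
move=> /set0Pn/sigW[x xI].
case: (arg_minnP (fun y : 'I_n => y : nat) xI) => u uI min_u.
exists u, (I :\ u); first by rewrite setD1K.
move=> y; rewrite !inE => /andP[yu yI].
by rewrite ltn_neqAle min_u // andbT eq_sym; apply: contraNneq yu => /val_inj->.
Qed.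

Lemma principal_minor_expand u S : (forall x, x \in S -> (u < x)%N) ->
  principal_minor A (u |: S) = \sum_(B : {set 'I_n} | B \subset S)
     (-1) ^+ #|B| * cycle_sum A (u |: B) * principal_minor A (S :\: B).
Proof.
move=> uS; rewrite principal_minorE perm_det_expand; last first.
  by apply/negP => /uS; rewrite ltnn.
apply: eq_bigr => B BS; rewrite principal_minorE cycle_sumU1 // => x xB.
by apply: uS; apply: (subsetP BS).
Qed.

Definition initial_set k : {set 'I_n} := [set i : 'I_n | (i < k)%N].

Lemma card_initial_set k : (k <= n)%N -> #|initial_set k| = k.
Proof.
move=> kn; rewrite -sum1dep_card.
under eq_bigl => i do rewrite -[(i < k)%N]/((fun j : nat => (j < k)%N) i).
by rewrite -(big_ord_widen _ (fun _ => 1%N)) // sum1_card card_ord.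
Qed.

Lemma symmetrized_minorsE : symmetrized_minors A ->
  forall I : {set 'I_n}, principal_minor A I = minor_of_order A #|I|.
Proof.
move=> sA I; apply: sA; rewrite card_initial_set //.
by rewrite -[X in (_ <= X)%N]card_ord max_card.
Qed.

Lemma symmetrized_cycle_sumsE : symmetrized_cycle_sums A ->
  forall I : {set 'I_n}, cycle_sum A I = cycle_sum_of_order A #|I|.
Proof.
move=> sA I; apply: sA; rewrite card_initial_set //.
by rewrite -[X in (_ <= X)%N]card_ord max_card.
Qed.

(** In the expansion at the least index, only the term of the full cycle involves [I] itself. All
    others depend on sizes alone, so the subsets of each size are counted by a binomial coefficient.
    Assuming this only for proper subsets allows an induction on size. *)
Lemma symmetrized_expand (d c : nat -> F) m (I : {set 'I_n}) :
  #|I| = m.+1 ->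
  (forall J : {set 'I_n}, J \proper I -> principal_minor A J = d #|J|) ->
  (forall J : {set 'I_n}, J \proper I -> cycle_sum A J = c #|J|) ->
  principal_minor A I = (-1) ^+ m * cycle_sum A I +
    \sum_(b < m) (-1) ^+ b * c b.+1 * d (m - b)%N *+ 'C(m, b).
Proof.
move=> cI dI cycI.
have [|u [S defI uS]] := set_minP (I := I); first by rewrite -card_gt0 cI.
have uS' : u \notin S by apply/negP => /uS; rewrite ltnn.
have cS : #|S| = m by move: cI; rewrite defI cardsU1 uS' => -[].
have subS B : B \subset S -> B != S -> #|u |: B| = #|B|.+1 /\ u |: B \proper I.
  move=> BS BnS; have uB : u \notin B by apply: contra uS'; apply: (subsetP BS).
  split; first by rewrite cardsU1 uB.
  rewrite properEcard defI setUS // !cardsU1 uB uS' /=.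
  by rewrite ltn_add2l proper_card // properEneq BnS.
have pS B : S :\: B \proper I.
  rewrite properEcard cI ltnS -cS subset_leq_card ?subsetDl // andbT defI.
  by rewrite (subset_trans (subsetDl _ _)) // subsetUr.
rewrite {1}defI principal_minor_expand // (bigD1 S) //= setDv cS -defI.
rewrite principal_minor_set0 mulr1; congr (_ + _).
(* The value 0 at [m] discards [B = S], whose term has been split off already. *)
pose h b := if b == m then 0 else (-1) ^+ b * c b.+1 * d (m - b)%N.
transitivity (\sum_(B : {set 'I_n} | B \subset S) h #|B|).
  rewrite [RHS](bigD1 S) //= /h cS eqxx add0r; apply: eq_bigr => B /andP[BS BnS].
  have [cB pB] := subS B BS BnS.
  rewrite cycI // cB dI // cardsD (setIidPr BS) cS ifN // -cS.
  by apply: contra BnS => /eqP cBS; rewrite eqEcard BS cBS leqnn.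
rewrite sum_subsets_card cS big_ord_recr /= /h eqxx mul0rn addr0.
by apply: eq_bigr => b _; rewrite ltn_eqF.
Qed.

Let agree k := forall I J : {set 'I_n}, #|I| = #|J| -> (#|I| <= k)%N ->
  principal_minor A I = principal_minor A J /\ cycle_sum A I = cycle_sum A J.

Let agree_diff m : agree m -> forall I J : {set 'I_n},
  #|I| = m.+1 -> #|J| = m.+1 ->
  principal_minor A I - principal_minor A J =
  (-1) ^+ m * (cycle_sum A I - cycle_sum A J).
Proof.
move=> agm I J cI cJ.
have prop (K L : {set 'I_n}) : #|K| = m.+1 -> L \proper K ->
    principal_minor A L = minor_of_order A #|L| /\
    cycle_sum A L = cycle_sum_of_order A #|L|.
  move=> cK /proper_card; rewrite cK ltnS => Lm; apply: agm => //.
  by rewrite card_initial_set // -[X in (_ <= X)%N]card_ord max_card.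
rewrite (symmetrized_expand cI (fun L LK => (prop _ L cI LK).1)
  (fun L LK => (prop _ L cI LK).2)).
rewrite (symmetrized_expand cJ (fun L LK => (prop _ L cJ LK).1)
  (fun L LK => (prop _ L cJ LK).2)).
by ring.
Qed.

(** By induction on size, the difference of two minors of the same order is, up to sign, that of the
    cycle-sums, so either one vanishes with the other. *)
Let agree_all : (symmetrized_minors A \/ symmetrized_cycle_sums A) ->
  forall k, agree k.
Proof.
move=> sA; elim=> [|m IH] I J IJ.
  rewrite leqn0 => I0; have -> : I = set0 by apply/eqP; rewrite -cards_eq0.
  by have -> : J = set0 by apply/eqP; rewrite -cards_eq0 -IJ.
rewrite leq_eqVlt => /orP[/eqP cI|]; last by rewrite ltnS; apply: IH.
have := agree_diff IH cI (etrans (esym IJ) cI).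
case: sA => sA; rewrite (sA I J IJ) subrr => H; split=> //.
  by apply/eqP; rewrite -subr_eq0 -(mulrI_eq0 _ (@lreg_sign F m)) -H.
by apply/eqP; rewrite -subr_eq0 H mulr0.
Qed.

Lemma symmetrized_minors_cycle_sums :
  symmetrized_minors A <-> symmetrized_cycle_sums A.
Proof.
split=> sA I J IJ.
  by have [] := agree_all (or_introl sA) IJ (leqnn _).
by have [] := agree_all (or_intror sA) IJ (leqnn _).
Qed.

End CycleExpansion.

(** * Band matrices, Eulerian polynomials and Euler numbers *)

Lemma ltn_enum_val n (I : {set 'I_n}) (i j : 'I_#|I|) :
  (@enum_val _ (mem I) i < @enum_val _ (mem I) j)%N = (i < j)%N.
Proof.
have mono (k l : 'I_#|I|) : (k < l)%N ->
    (@enum_val _ (mem I) k < @enum_val _ (mem I) l)%N.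
  move=> kl; rewrite (enum_val_nth (enum_val k)) (enum_val_nth (enum_val k) l).
  apply: (sorted_ltn_nth _ _ (enum_set_sorted I)) => //.
  - by move=> ? ? ?; apply: ltn_trans.
  - by rewrite inE -cardE.
  - by rewrite inE -cardE.
case: (ltngtP i j) => [/mono //|/mono ji|/val_inj->]; last by rewrite ltnn.
by apply/negbTE; rewrite -leqNgt ltnW.
Qed.

(** * Determinants of band matrices *)

Section BandMatrix.
Variable F : fieldType.
Implicit Types c a b : F.

Definition band_mx n c a b : 'M[F]_n :=
  \matrix_(i, j) if i == j then c else if (i < j)%N then a else b.

Lemma principal_minor_band n c a b (I : {set 'I_n}) :
  principal_minor (band_mx n c a b) I = \det (band_mx #|I| c a b).
Proof.
rewrite /principal_minor; congr (\det _); apply/matrixP => i j.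
by rewrite !mxE ltn_enum_val (inj_eq enum_val_inj).
Qed.

Lemma band_symmetrized_minors n c a b : symmetrized_minors (band_mx n c a b).
Proof. by move=> I J IJ; rewrite !principal_minor_band IJ. Qed.

Lemma minor_of_order_band n c a b k : (k <= n)%N ->
  minor_of_order (band_mx n c a b) k = \det (band_mx k c a b).
Proof.
move=> kn; rewrite /minor_of_order principal_minor_band.
by rewrite (card_initial_set kn).
Qed.

(* Subtracting the second row from the first leaves two nonzero entries in the
   first row. *)
Lemma det_band_rec c a b k :
  \det (band_mx k.+2 c a b) =
  (2 * c - a - b) * \det (band_mx k.+1 c a b)
  - (c - a) * (c - b) * \det (band_mx k c a b).
Proof.
pose M := band_mx k.+2 c a b; pose i1 : 'I_k.+2 := lift ord0 ord0.
have cof00 : cofactor M ord0 ord0 = \det (band_mx k.+1 c a b).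
  rewrite /cofactor mul1r; congr (\det _); apply/matrixP => i j.
  by rewrite !mxE (inj_eq lift_inj).
have cof01 : cofactor M ord0 i1 =
    - (\det (band_mx k.+1 c a b) + (b - c) * \det (band_mx k c a b)).
  rewrite /cofactor /= /bump /= expr1 mulN1r; congr (- _).
  (* [N] is the band matrix of size [k.+1] with its corner entry [c] replaced by [b], so the
     cofactors along the first row agree. *)
  set N := row' _ _.
  have cofN j : cofactor N ord0 j = cofactor (band_mx k.+1 c a b) ord0 j.
    rewrite /cofactor; congr (_ * \det _); apply/matrixP => i l.
    rewrite !mxE -!val_eqE /= /bump /=.
    by case: (_ + l)%N => [|q]; rewrite ?add0n ?add1n ?eqSS ?ltnS.
  rewrite (expand_det_row N ord0) (expand_det_row (band_mx k.+1 c a b) ord0).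
  rewrite !big_ord_recl /= !cofN !mxE /=.
  have -> : cofactor (band_mx k.+1 c a b) ord0 ord0 = \det (band_mx k c a b).
    rewrite /cofactor mul1r; congr (\det _); apply/matrixP => i j.
    by rewrite !mxE (inj_eq lift_inj).
  under eq_bigr do rewrite cofN !mxE /=.
  under [X in _ = _ + X + _]eq_bigr do rewrite !mxE /=.
  ring.
have row1 : \sum_j M i1 j * cofactor M ord0 j = 0.
  transitivity ((M *m \adj M) i1 ord0); last by rewrite mul_mx_adj !mxE.
  by rewrite [RHS]mxE; apply: eq_bigr => j _; rewrite [\adj M _ _]mxE.
have -> : \det (band_mx k.+2 c a b) =
    \sum_j (M ord0 j - M i1 j) * cofactor M ord0 j.
  under [RHS]eq_bigr do rewrite mulrBl.
  by rewrite sumrB row1 subr0 -expand_det_row.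
rewrite !big_ord_recl big1 => [|j _]; last by rewrite !mxE /= subrr mul0r.
rewrite cof00 cof01 !mxE /=; ring.
Qed.
Lemma det_band0 c a b : \det (band_mx 0 c a b) = 1.
Proof. exact: det_mx00. Qed.

Lemma det_band1 c a b : \det (band_mx 1 c a b) = c.
Proof. by rewrite det_mx11 mxE eqxx. Qed.

(** The characteristic roots of the recurrence are [c - a] and [c - b]. The factor [a - b] avoids a
    division, but leaves no information when [a = b]. *)
Lemma det_band_distinct c a b k :
  (a - b) * \det (band_mx k c a b) = a * (c - b) ^+ k - b * (c - a) ^+ k.
Proof.
have [m] := ubnP k; elim: m => // m IH in k *.
case: k => [|[|k]] km; first by rewrite det_band0 !expr0; ring.
  by rewrite det_band1 !expr1; ring.
have IH1 := IH k.+1 km; have IH0 := IH k (ltnW km).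
transitivity ((2 * c - a - b) * ((a - b) * \det (band_mx k.+1 c a b))
   - (c - a) * (c - b) * ((a - b) * \det (band_mx k c a b))).
  by rewrite det_band_rec; ring.
by rewrite IH1 IH0 !exprS; ring.
Qed.

(** Here [c - a] is a double root of the recurrence, whence the factor linear in [k]. *)
Lemma det_band_equal c a k :
  \det (band_mx k.+1 c a a) = (c - a) ^+ k * (c - a + k.+1%:R * a).
Proof.
have [m] := ubnP k; elim: m => // m IH in k *.
case: k => [|[|k]] km; first by rewrite det_band1 expr0; ring.
  by rewrite det_band_rec det_band1 det_band0 expr1; ring.
have IH1 := IH k.+1 km; have IH0 := IH k (ltnW km).
rewrite det_band_rec IH1 IH0 !exprS.
by rewrite -[k.+3]addn3 -[k.+2]addn2 -[k.+1]addn1 !natrD; ring.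
Qed.

End BandMatrix.

(** * Invariance under diagonal conjugation *)

Section DiagonalConjugation.
Variables (F : fieldType) (n : nat) (A B : 'M[F]_n) (d : 'I_n -> F).
Hypothesis d_neq0 : forall i, d i != 0.
Hypothesis AB : forall i j, A i j = d i * B i j / d j.

Lemma principal_minor_diag_conj I : principal_minor A I = principal_minor B I.
Proof.
rewrite !principal_minorE; apply: eq_bigr => s sI; congr (_ * _).
under eq_bigr do rewrite AB.
rewrite !big_split /= mulrAC -[RHS]mul1r; congr (_ * _).
rewrite prodfV (reindex_inj (@perm_inj _ s)) /=.
rewrite (eq_bigl (mem I)) => [|i]; last exact: perm_closed.
by rewrite mulfV //; apply/prodf_neq0.
Qed.

Lemma path_prod_diag_conj u v p :
  path_prod A u v p = d u * path_prod B u v p / d v.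
Proof.
elim: p u => [|j p IH] u; first by rewrite !path_prod_nil AB.
by rewrite !path_prod_cons IH AB; field; rewrite !d_neq0.
Qed.

Lemma path_sum_diag_conj u v S :
  path_sum A u v S = d u * path_sum B u v S / d v.
Proof.
rewrite /path_sum /ord_sum mulr_sumr mulr_suml.
by apply: eq_bigr => p _; exact: path_prod_diag_conj.
Qed.

Lemma cycle_sum_diag_conj I : cycle_sum A I = cycle_sum B I.
Proof.
have [->|/set_minP[u [S -> uS]]] := eqVneq I set0.
  by rewrite !cycle_sum_set0.
by rewrite !cycle_sumU1 // path_sum_diag_conj mulrAC mulfV // mul1r.
Qed.

End DiagonalConjugation.

(** Conjugating by the powers of [x] absorbs [x ^ (j - i)]; the correction by the sign in the
    exponent leaves the constants [x^-1] above and [- x] below the diagonal. *)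
Lemma T_mx_band (F : fieldType) n (x : F) (i j : 'I_n) : x != 0 ->
  T_mx n x i j = x ^- i * band_mx n 0 x^-1 (- x) i j / x ^- j.
Proof.
move=> x0; rewrite !mxE; case: eqP => [_|/eqP ij]; first by rewrite mulr0 mul0r.
rewrite invrK; cbv zeta; case: ltngtP => [lt|lt|/val_inj/eqP]; last by rewrite (negPf ij).
  have [m jm] : exists m, nat_of_ord j = (i + m.+1)%N by exists (j - i).-1; lia.
  have -> : j%:Z - i%:Z = m.+1%:Z by rewrite jm; lia.
  rewrite gtr0_sgz // mul1r.
  have -> : m.+1%:Z - 1 = m by lia.
  by rewrite -exprnP jm exprD exprS; field; rewrite x0 expf_neq0.
have [m im] : exists m, nat_of_ord i = (j + m.+1)%N by exists (i - j).-1; lia.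
have -> : j%:Z - i%:Z = - m.+1%:Z by rewrite im; lia.
rewrite ltr0_sgz ?oppr_lt0 //.
have -> : - m.+1%:Z - -1 = - m%:Z by lia.
rewrite -exprnN im exprD exprS mulN1r.
by field; rewrite ?x0 ?expf_neq0.
Qed.

Fixpoint word_des (s : seq nat) : nat :=
  if s is x :: s' then ((head x s' < x) + word_des s')%N else 0.

(* [b] tells whether the first step has to be a descent. *)
Fixpoint alternating_word (b : bool) (s : seq nat) : bool :=
  if s is x :: s' then
    (if s' is y :: _ then (y < x)%N == b else true) &&
    alternating_word (~~ b) s'
  else true.

Lemma word_desE s :
  word_des s = (\sum_(i < (size s).-1) (nth 0 s i.+1 < nth 0 s i))%N.
Proof.
elim: s => [|x [|y s] IH]; rewrite ?big_ord0 //=; first by rewrite ltnn.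
by rewrite big_ord_recl -[X in (_ + X)%N = _]/(word_des (y :: s)) IH.
Qed.

Lemma alternating_wordP b s :
  reflect (forall i, (i.+1 < size s)%N ->
             ((nth 0 s i.+1 < nth 0 s i)%N == b (+) odd i))
          (alternating_word b s).
Proof.
elim: s b => [|x [|y s] IH] b; try by constructor.
apply: (iffP andP) => [[xy /IH alt] [|i] /= lti|alt].
- by rewrite addbF.
- by have := alt i lti; rewrite addbN addNb.
split; first by have := alt 0 isT; rewrite addbF.
by apply/IH => i lti; have := alt i.+1 lti; rewrite /= addbN addNb.
Qed.

(** * Orderings of a set as permutations, with their descents *)

Section Words.
Variables (n : nat) (S : {set 'I_n}).
Let ev : 'I_#|S| -> 'I_n := @enum_val _ (mem S).

Definition word_of (w : 'S_#|S|) : seq 'I_n :=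
  [seq ev (w i) | i <- enum 'I_#|S|].

Lemma ord_sum_words (V : nmodType) (f : seq 'I_n -> V) :
  ord_sum S f = \sum_(w : 'S_#|S|) f (word_of w).
Proof.
have uniqW : uniq [seq word_of w | w <- enum 'S_#|S|].
  rewrite map_inj_uniq ?enum_uniq // => w1 w2 /eq_in_map eqw.
  by apply/permP => i; apply/enum_val_inj/eqw; rewrite mem_enum.
have subW : {subset [seq word_of w | w <- enum 'S_#|S|] <= permutations (enum S)}.
  move=> p /mapP[w _ ->]; rewrite mem_permutations; apply: uniq_perm.
  - rewrite map_inj_uniq ?enum_uniq // => i j /enum_val_inj; exact: perm_inj.
  - exact: enum_uniq.
  move=> x; rewrite mem_enum; apply/mapP/idP => [[i _ ->]|xS].
    exact: enum_valP.
  exists ((w^-1)%g (enum_rank_in xS x)); first by rewrite mem_enum.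
  by rewrite permKV /ev enum_rankK_in.
(* Both lists have [#|S|] factorial members, so the inclusion [subW] is an equality. *)
have szW : (size (permutations (enum S)) <= size [seq word_of w | w <- enum 'S_#|S|])%N.
  rewrite size_permutations ?enum_uniq // size_map -!cardE.
  by have := card_Sn #|S|; rewrite /= => ->.
have [_ eqW] := uniq_min_size uniqW subW szW.
rewrite /ord_sum (perm_big [seq word_of w | w <- enum 'S_#|S|]); last first.
  by apply: uniq_perm; rewrite ?permutations_uniq // => p; rewrite eqW.
by rewrite big_map big_enum.
Qed.

Lemma size_word_of w : size (word_of w) = #|S|.
Proof. by rewrite size_map size_enum_ord. Qed.

Lemma nth_word_of w (i : 'I_#|S|) :
  nth 0%N (map val (word_of w)) i = ev (w i) :> nat.
Proof.
rewrite (nth_map (ev i)) ?size_word_of // (nth_map i) ?size_enum_ord //.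
by rewrite nth_ord_enum.
Qed.

Lemma word_des_word_of w : word_des (map val (word_of w)) = des w.
Proof.
set t := map val (word_of w).
have szt : size t = #|S| by rewrite size_map size_word_of.
rewrite word_desE /des -sum1_card.
(* The bound inside [Q] makes the last position contribute 0, so that both sums can range over all
   of ['I_#|S|]. *)
pose Q i : nat := (i.+1 < #|S|)%N && (nth 0 t i.+1 < nth 0 t i)%N.
transitivity (\sum_(0 <= i < #|S|) Q i)%N.
  rewrite szt; case cS: #|S| => [|m]; first by rewrite big_ord0 big_nil.
  rewrite big_nat_recr //= big_mkord [X in (_ + X)%N](_ : _ = 0%N) ?addn0.
    by apply: eq_bigr => i _; rewrite /Q cS ltnS ltn_ord.
  by rewrite /Q cS ltnn.
rewrite big_mkord [RHS]big_mkcond; apply: eq_bigr => i _; rewrite inE /Q.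
case: ltnP => [lti|ge]; last first.
  rewrite ifN //; apply/existsPn => j; case: eqP => //= ji.
  by move: ge; rewrite -ji leqNgt ltn_ord.
rewrite (nth_word_of w (Ordinal lti)) nth_word_of ltn_enum_val /=.
case: ifP => [/existsP[j /andP[/eqP ji]]|/negbT/existsPn/(_ (Ordinal lti))].
  by rewrite (_ : j = Ordinal lti) => [->|]; last exact: val_inj.
by rewrite /= eqxx /= => /negPf->.
Qed.

Lemma alternating_word_of w :
  alternating_word true (map val (word_of w)) = alternating_perm w.
Proof.
apply/alternating_wordP/forallP => [alt i|alt i].
  apply/forallP => j; apply/implyP => /eqP ji.
  have := alt i; rewrite size_map size_word_of -ji => /(_ (ltn_ord j)).
  by rewrite !nth_word_of ltn_enum_val.
rewrite size_map size_word_of => lti.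
have := alt (Ordinal (ltnW lti)) => /forallP/(_ (Ordinal lti)).
rewrite (nth_word_of w (Ordinal lti)) (nth_word_of w (Ordinal (ltnW lti))).
by rewrite ltn_enum_val /= eqxx.
Qed.

Lemma ord_sum_word_des (R : pzRingType) (y : R) :
  ord_sum S (fun p => y ^+ word_des (map val p)) =
  \sum_(w : 'S_#|S|) y ^+ des w.
Proof.
by rewrite ord_sum_words; apply: eq_bigr => w _; rewrite word_des_word_of.
Qed.

Lemma ord_sum_alternating (R : pzRingType) :
  ord_sum S (fun p => (alternating_word true (map val p))%:R : R) =
  (euler_number #|S|)%:R.
Proof.
rewrite ord_sum_words /euler_number -sum1dep_card natr_sum [RHS]big_mkcond.
apply: eq_bigr => w _; rewrite alternating_word_of.
by case: alternating_perm.
Qed.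

Lemma ord_sum_sorted (R : pzRingType) :
  ord_sum S (fun p => (sorted leq (map val p))%:R : R) = 1.
Proof.
rewrite /ord_sum (bigD1_seq (enum S)) ?permutations_uniq ?mem_permutations //=.
have srt : sorted leq (map val (enum S)).
  rewrite sorted_map; apply: sub_sorted (enum_set_sorted S) => x y /ltnW //.
rewrite srt big1_seq ?addr0 // => p /andP[pS]; rewrite mem_permutations => perm_p.
have [sp|//] := boolP (sorted leq (map val p)); case/eqP: pS; apply: (inj_map val_inj).
by apply: (sorted_eq leq_trans anti_leq) => //; exact: perm_map.
Qed.

End Words.

(** * A recursion for the Euler numbers of odd index *)

Section EulerNumbers.
Variable R : comPzRingType.

Definition euler_term (L : seq nat) : R :=
  if odd (size L) then (-1) ^+ (size L).-1./2 * (alternating_word true L)%:R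
  else 0.

(** Two more letters flip the sign and require a descent followed by an ascent. The default of
    [head] is harmless: with no letters left, both sides vanish. *)
Lemma euler_term_rec x y z L :
  euler_term (x :: y :: take L z) =
  - ((y < x) && (y <= head y z))%N%:R * euler_term (take L z).
Proof.
case: L z => [|L] [|z s]; rewrite /euler_term /= ?mulr0 //.
rewrite negbK; case: ifP => odds; last by rewrite mulr0.
rewrite eqb_id eqbF_neg -leqNgt exprS.
by case: (y < x)%N; case: (y <= z)%N => /=; ring.
Qed.

(* Cut a word of odd length into an alternating prefix of odd length and an
   increasing suffix: consecutive signed terms telescope, since lengthening the
   prefix by 2 requires a descent followed by an ascent. *)
Lemma euler_telescope (s : seq nat) : odd (size s) ->
  \sum_(i < (size s).+1) euler_term (take i s) * (sorted leq (drop i s))%:R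
  = (sorted leq s)%:R.
Proof.
have [k] := ubnP (size s); elim: k => // k IH in s *.
case: s => [|x [|y [|z s]]] //= szs.
  by move=> _; rewrite !big_ord_recl big_ord0 /euler_term /= !mul0r !mul1r add0r addr0.
rewrite !negbK => odds.
rewrite big_ord_recl {1}/euler_term /= mul0r add0r.
rewrite big_ord_recl {1}/euler_term /= expr0 mul1r mul1r.
transitivity ((path leq y (z :: s))%:R - ((y < x) && (y <= z))%N%:R *
  \sum_(i < (size (z :: s)).+1)
     euler_term (take i (z :: s)) * (sorted leq (drop i (z :: s)))%:R : R).
  rewrite mulr_sumr -sumrN; congr (_ + _); apply: eq_bigr => i _.
  rewrite [X in euler_term X](_ : _ = x :: y :: take i (z :: s)) //.
  by rewrite euler_term_rec; ring.
rewrite IH //=; last by lia.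
by rewrite (leqNgt x); case: (y < x)%N; case: (y <= z)%N; rewrite /=; ring.
Qed.

(** In terms of generating functions, tanh x cosh x = sinh x. Each subset [B] is arranged as an
    alternating prefix and its complement as the unique increasing suffix. By [euler_telescope],
    only the increasing ordering of the whole set survives. *)
Lemma euler_number_recursion m : odd m ->
  \sum_(b < m.+1) (if odd b then (-1) ^+ b.-1./2 * (euler_number b)%:R else 0 : R)
    *+ 'C(m, b) = 1.
Proof.
move=> odd_m; pose S := [set: 'I_m].
have cS : #|S| = m by rewrite cardsT card_ord.
rewrite -[in LHS]cS -(sum_subsets_card S
  (fun b => if odd b then (-1) ^+ b.-1./2 * (euler_number b)%:R else 0 : R)).
rewrite -[RHS](ord_sum_sorted S R).
transitivity (ord_sum S (fun p => \sum_(i < (size p).+1)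
    euler_term (map val (take i p)) * (sorted leq (map val (drop i p)))%:R)).
  rewrite (ord_sum_cat S
    (fun L D => euler_term (map val L) * (sorted leq (map val D))%:R)).
  apply: eq_bigr => B _; transitivity (ord_sum B (fun L => euler_term (map val L))).
    rewrite -ord_sum_alternating.
    case: ifP => oddB; last first.
      rewrite /ord_sum big1_seq // => p; rewrite mem_permutations => /perm_size szp.
      by rewrite /euler_term size_map szp -cardE oddB.
    rewrite /ord_sum mulr_sumr; apply: eq_big_seq => p.
    rewrite mem_permutations => /perm_size szp.
    by rewrite /euler_term size_map szp -cardE oddB.
  apply: eq_bigr => L _; rewrite -[LHS]mulr1 -[in LHS](ord_sum_sorted (S :\: B) R).
  by rewrite /ord_sum mulr_sumr.
apply: eq_ord_sum => p /perm_size szp.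
rewrite -euler_telescope size_map ?szp -?cardE ?cS //.
by apply: eq_bigr => i _; rewrite map_take map_drop.
Qed.

End EulerNumbers.

(** * Cycle-sums of band matrices *)

Section BandCycleSums.
Variables (F : fieldType) (n : nat).
Implicit Types (S : {set 'I_n}) (c a b x y : F).

(** With [a * y] below the diagonal, every step gives a factor [a] and every descent an additional
    [y]; distinct neighbours keep [c] out. *)
Lemma path_prod_band c a y u v (p : seq 'I_n) :
  path (fun i j => i != j) u (rcons p v) ->
  path_prod (band_mx n c a (a * y)) u v p =
  a ^+ (size p).+1 * y ^+ word_des (map val (u :: rcons p v)).
Proof.
have entry i j : i != j -> band_mx n c a (a * y) i j = a * y ^+ (j < i)%N.
  rewrite mxE => /[dup] ij /negPf->.
  by case: ltngtP => [||/val_inj/eqP]; rewrite ?mulr1 ?(negPf ij).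
elim: p u => [|j p IH] u /= /andP[uj pj].
  by rewrite path_prod_nil entry //= !addn0 ltnn addn0 expr1.
  by rewrite path_prod_cons IH // entry // mulrACA -exprS -exprD.
Qed.

(** Leaving the minimum is an ascent and returning to it a descent. This accounts for the exponent
    [des + 1] in the Eulerian polynomial. *)
Lemma word_des_rcons_min u s : s != [::] -> all (ltn u) s ->
  word_des (u :: rcons s u) = (word_des s).+1.
Proof.
case: s => // x s _ /= /andP[ux us]; rewrite ltnNge (ltnW ux) add0n.
elim: s x ux us => [|y s IH] x ux us /=; first by rewrite ux !ltnn.
by case/andP: us => uy us; have /= -> := IH y uy us; rewrite addnS.
Qed.

Lemma cycle_sum_band c a y k : (1 < k <= n)%N ->
  cycle_sum_of_order (band_mx n c a (a * y)) k =
  a ^+ k * (eulerian_poly k.-1).[y].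
Proof.
case: k => [|m]//= /andP[m_gt0 kn]; have n_gt0 : (0 < n)%N by lia.
pose u := Ordinal n_gt0; pose S := initial_set n m.+1 :\ u.
have uS i : i \in S -> (u < i)%N.
  by rewrite !inE lt0n -val_eqE => /andP[].
have defI : initial_set n m.+1 = u |: S by rewrite setD1K // inE.
have cS : #|S| = m.
  by have := card_initial_set kn; rewrite defI cardsU1 !inE eqxx /= => -[].
rewrite /cycle_sum_of_order -/(initial_set n m.+1) defI cycle_sumU1 //.
transitivity (ord_sum S (fun p => a ^+ m.+1 * y * y ^+ word_des (map val p))).
  apply: eq_ord_sum => p pS; have szp : size p = m by rewrite (perm_size pS) -cardE.
  have pu : all (fun i : 'I_n => (u < i)%N) p.
    by apply/allP => i; rewrite (perm_mem pS) mem_enum => /uS.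
  rewrite path_prod_band.
    rewrite szp map_cons map_rcons word_des_rcons_min; first by rewrite (exprS y) mulrA.
    - by rewrite -size_eq0 size_map szp -lt0n.
    - by rewrite all_map.
  rewrite rcons_path; apply/andP; split; last first.
    case/lastP: p szp pu {pS} => [sz0|p i _]; first by rewrite -sz0 in m_gt0.
    by rewrite last_rcons all_rcons neq_ltn => /andP[->]; rewrite orbT.
  have : uniq (u :: p).
    rewrite /= (perm_uniq pS) enum_uniq andbT.
    by apply/negP => /(allP pu); rewrite ltnn.
  rewrite -[path _ _ _]/(sorted _ (u :: p)) uniq_pairwise => /pairwise_sorted.
  by [].
rewrite /ord_sum -mulr_sumr -/(ord_sum S _) ord_sum_word_des cS.
rewrite /eulerian_poly horner_sum -mulrA mulr_sumr; congr (_ * _).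
by apply: eq_bigr => w _; rewrite hornerXn exprS.
Qed.

Lemma skew_ones_band : skew_ones_mx n = band_mx n 0 1 (-1) :> 'M[F]_n.
Proof.
apply/matrixP => i j; rewrite !mxE.
by case: ltngtP => [lt|lt|/val_inj->];
  rewrite ?eqxx // -val_eqE ?(ltn_eqF lt) ?(gtn_eqF lt).
Qed.

Lemma det_skew_ones k : 2 != 0 :> F ->
  \det (band_mx k 0 1 (-1) : 'M[F]_k) = (~~ odd k)%:R.
Proof.
move=> two; apply: (mulfI two); have := det_band_distinct (0 : F) 1 (-1) k.
rewrite !opprK sub0r add0r expr1n -signr_odd => ->.
by case: odd; rewrite /= ?expr1 ?expr0; ring.
Qed.

(** Minors of odd order vanish, so the expansion of an even-order minor, which equals 1, involves
    only cycle-sums of even order. By strong induction it becomes the recursion of the Euler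
    numbers. *)
Lemma cycle_sum_skew_ones k : 2 != 0 :> F -> (2 <= k <= n)%N -> ~~ odd k ->
  cycle_sum_of_order (skew_ones_mx n) k =
  (-1) ^+ k./2 * (euler_number k.-1)%:R :> F.
Proof.
move=> two; have [m] := ubnP k; elim: m => // m IH in k *.
case: k => // k; rewrite ltnS /= => km /andP[k_gt0 kn]; rewrite negbK => odd_k.
set W := skew_ones_mx n.
have sW : symmetrized_minors W.
  by rewrite /W skew_ones_band; exact: band_symmetrized_minors.
have sW' := (symmetrized_minors_cycle_sums W).1 sW.
have dW j : (j <= n)%N -> minor_of_order W j = (~~ odd j)%:R.
  by move=> jn; rewrite /W skew_ones_band minor_of_order_band // det_skew_ones.
have cI := card_initial_set kn.
have := symmetrized_expand cI (fun J _ => symmetrized_minorsE sW J)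
  (fun J _ => symmetrized_cycle_sumsE sW' J).
rewrite -[principal_minor _ _]/(minor_of_order W k.+1) dW //= negbK odd_k.
rewrite -[cycle_sum _ _]/(cycle_sum_of_order W k.+1).
rewrite -signr_odd odd_k expr1 mulN1r.
set e := (\sum_(b < k) _); set E := (-1) ^+ _ * _ => one_e.
have half_sign (b : nat) : odd b -> (-1) ^+ b.+1./2 = - (-1) ^+ b.-1./2 :> F.
  by case: b => // b _; rewrite /= exprS mulN1r.
(* The claimed value is the opposite of the top term of the Euler recursion; what remains is to
   match the lower terms. *)
have defE : E = - ((-1) ^+ k.-1./2 * (euler_number k)%:R).
  by rewrite /E -mulNr -half_sign.
have := euler_number_recursion F odd_k.
rewrite big_ord_recr /= odd_k binn mulr1n -[_ * _]opprK -defE => E_e.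
suff ee : e = \sum_(b < k)
    (if odd b then (-1) ^+ b.-1./2 * (euler_number b)%:R else 0) *+ 'C(k, b).
  transitivity (e - 1); first by rewrite [X in _ - X]one_e; ring.
  by rewrite -E_e ee; ring.
apply: eq_bigr => b _; congr (_ *+ _); have bk := ltn_ord b.
rewrite dW ?(leq_trans (leq_subr _ _)) 1?ltnW // oddB 1?ltnW // odd_k addTb negbK.
case: ifP => odd_b; last by rewrite mulr0.
rewrite -signr_odd odd_b expr1 mulN1r mulr1.
case: b bk odd_b => -[|b] //= ? bk odd_b.
rewrite IH /= ?odd_b //; last 2 first.
- by lia.
- by lia.
by rewrite exprS mulN1r mulNr opprK.
Qed.

End BandCycleSums.

(** * Minors and cycle-sums of the model matrices *)

Section SpecialValues.
Variables (F : fieldType) (n : nat).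
Implicit Types x lambda mu : F.

Lemma ones_band lambda mu :
  lambda *: ones_mx n + mu%:M = band_mx n (mu + lambda) lambda lambda.
Proof.
apply/matrixP => i j; rewrite !mxE mulr1 if_same addrC.
by case: eqP => _; rewrite ?mulr1n ?mulr0n ?add0r.
Qed.

Lemma minor_of_order_ones lambda mu k : (0 < k <= n)%N ->
  minor_of_order (lambda *: ones_mx n + mu%:M) k =
  mu ^+ k.-1 * (mu + k%:R * lambda).
Proof.
case: k => // k /= kn; rewrite ones_band minor_of_order_band //.
by rewrite det_band_equal addrK.
Qed.

Lemma cycle_sum_ones lambda mu k : (1 < k <= n)%N ->
  cycle_sum_of_order (lambda *: ones_mx n + mu%:M) k =
  (k.-1)`!%:R * lambda ^+ k.
Proof.
move=> kn; rewrite ones_band -[X in band_mx _ _ _ X](mulr1 lambda).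
rewrite cycle_sum_band // mulrC; congr (_ * _).
rewrite /eulerian_poly horner_sum -card_Sn -sum1_card natr_sum.
by apply: eq_bigr => w _; rewrite hornerXn expr1n.
Qed.

Lemma T_mx_symmetrized_minors x : x != 0 -> symmetrized_minors (T_mx n x).
Proof.
move=> x0 I J IJ.
have dn0 (i : 'I_n) : x ^- i != 0 by rewrite invr_eq0 expf_neq0.
rewrite !(principal_minor_diag_conj dn0 (fun i j => T_mx_band i j x0)).
exact: band_symmetrized_minors.
Qed.

Let scaled_T_mx_band x : x != 0 -> forall i j : 'I_n,
  (x *: T_mx n x) i j = x ^- i * band_mx n 0 1 (- x ^+ 2) i j / x ^- j.
Proof.
move=> x0 i j; rewrite mxE T_mx_band // !mxE.
case: eqP => _; first by rewrite !(mulr0, mul0r).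
by case: ltnP => _; field; rewrite ?oner_neq0 ?x0 ?expf_neq0.
Qed.

Lemma scaled_T_mx_symmetrized_minors x : x != 0 ->
  symmetrized_minors (x *: T_mx n x).
Proof.
move=> x0 I J IJ.
have dn0 (i : 'I_n) : x ^- i != 0 by rewrite invr_eq0 expf_neq0.
rewrite !(principal_minor_diag_conj dn0 (scaled_T_mx_band x0)).
exact: band_symmetrized_minors.
Qed.

Lemma cycle_sum_T_mx x s : x != 0 -> (1 < s <= n)%N ->
  cycle_sum_of_order (T_mx n x) s = x ^- s * (eulerian_poly s.-1).[- x ^+ 2].
Proof.
move=> x0 sn; have dn0 (i : 'I_n) : x ^- i != 0 by rewrite invr_eq0 expf_neq0.
rewrite /cycle_sum_of_order.
rewrite (cycle_sum_diag_conj dn0 (fun i j => T_mx_band i j x0)).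
have -> : - x = x^-1 * - x ^+ 2 by field.
by rewrite -[LHS]/(cycle_sum_of_order _ s) cycle_sum_band // exprVn.
Qed.

Lemma minor_of_order_T_mx x s : x != 0 -> (1 < s <= n)%N -> x ^+ 2 != - 1 ->
  minor_of_order (T_mx n x) s =
  ((x ^+ 2) ^+ s.-1 + (-1) ^+ s) / (x ^+ (s - 2) * (x ^+ 2 + 1)).
Proof.
move=> x0 /andP[s1 sn]; rewrite -subr_eq0 opprK => x2.
have dn0 (i : 'I_n) : x ^- i != 0 by rewrite invr_eq0 expf_neq0.
rewrite /minor_of_order.
rewrite (principal_minor_diag_conj dn0 (fun i j => T_mx_band i j x0)).
rewrite -[LHS]/(minor_of_order _ s) minor_of_order_band //.
case: s s1 {sn} => [|[|t]] // _; rewrite !subSS subn0 /=.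
have := det_band_distinct 0 x^-1 (- x) t.+2.
rewrite !opprK add0r sub0r => det_eq.
have nz : x^-1 + x != 0.
  by have -> : x^-1 + x = (x ^+ 2 + 1) / x; [field | rewrite mulf_neq0 ?invr_eq0].
apply: (mulfI nz); rewrite det_eq -exprM mul2n -addnn.
rewrite (exprNn x^-1) exprVn !exprD !exprS !expr0.
by field; rewrite x0 x2 expf_neq0.
Qed.

(** After scaling by [x] the constants are 1 and [- x ^+ 2], whose difference is the factor on the
    left. No division occurs, so [x ^+ 2 = - 1] is allowed. *)
Lemma minor_of_order_scaled_T_mx x s : x != 0 -> (1 < s <= n)%N ->
  (x ^+ 2 + 1) * minor_of_order (x *: T_mx n x) s =
  x ^+ (2 * s) + (-1) ^+ s * x ^+ 2.
Proof.
move=> x0 /andP[s1 sn].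
have dn0 (i : 'I_n) : x ^- i != 0 by rewrite invr_eq0 expf_neq0.
rewrite /minor_of_order (principal_minor_diag_conj dn0 (scaled_T_mx_band x0)).
rewrite -/(minor_of_order _ s) minor_of_order_band //.
have := det_band_distinct 0 1 (- x ^+ 2) s.
by rewrite !opprK add0r sub0r mul1r -exprM [1 + _]addrC => ->; ring.
Qed.

End SpecialValues.

(** * Conjugation by permutation and diagonal matrices *)

Section ConjugateMatrices.
Variables (F : fieldType) (n : nat).
Implicit Types (A B : 'M[F]_n).

(** The conjugating matrix is a diagonal matrix times a permutation matrix; conjugations are
    exhibited below by giving [d] and [s]. *)
Lemma conjugate_mx_entries A B (d : 'I_n -> F) (s : 'S_n) :
  (forall i, d i != 0) -> (forall i j, A i j = d i * B (s i) (s j) / d j) ->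
  conjugate_mx A B.
Proof.
move=> d0 AB; pose D := diag_mx (\row_i d i).
have uD : D \in unitmx.
  rewrite unitmxE det_diag unitfE; apply/prodf_neq0 => i _.
  by rewrite mxE.
have uP : D *m perm_mx s \in unitmx by rewrite unitmx_mul uD unitmx_perm.
exists (D *m perm_mx s); first exact: (pdg_mul (pdg_diag uD) (pdg_perm _ s)).
suff <- : A *m (D *m perm_mx s) = D *m perm_mx s *m B by rewrite mulmxK.
apply/matrixP => i j; rewrite mulmxA -{1}[s]invgK -col_permE -mulmxA -row_permE.
rewrite mul_diag_mx mul_mx_diag !mxE AB.
by rewrite permKV -mulrA mulVf ?mulr1.
Qed.

Lemma conjugate_mx_diag A B (d : 'I_n -> F) :
  (forall i, d i != 0) -> (forall i j, A i j = d i * B i j / d j) ->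
  conjugate_mx A B.
Proof.
move=> d0 AB; apply: (conjugate_mx_entries (s := 1%g) d0) => i j.
by rewrite !perm1.
Qed.

Lemma conjugate_mx_refl A : conjugate_mx A A.
Proof.
apply: (@conjugate_mx_diag _ _ (fun=> 1)) => [i|i j]; first exact: oner_neq0.
by rewrite mul1r divr1.
Qed.

Lemma perm_diag_group_unitmx (P : 'M[F]_n) : perm_diag_group P -> P \in unitmx.
Proof.
elim=> {P} [s|d //|P Q _ uP _ uQ|P _]; first exact: unitmx_perm.
- by rewrite unitmx_mul uP.
- by rewrite unitmx_inv.
Qed.

Lemma conjugate_mx_trans A B C :
  conjugate_mx A B -> conjugate_mx B C -> conjugate_mx A C.
Proof.
move=> [P gP ->] [Q gQ ->]; exists (P *m Q); first exact: pdg_mul.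
have uP := perm_diag_group_unitmx gP; have uQ := perm_diag_group_unitmx gQ.
have uPQ : P *m Q \in unitmx by rewrite unitmx_mul uP.
apply: (can_inj (mulmxK uPQ)); rewrite mulmxKV // !mulmxA.
by rewrite mulmxKV // mulmxKV.
Qed.

(** Each index is sent to its number of predecessors, which increases strictly along [r] and is
    therefore injective. *)
Lemma strict_order_perm (r : rel 'I_n) :
  irreflexive r -> transitive r -> (forall i j, i != j -> r i j || r j i) ->
  exists s : 'S_n, forall i j, r i j = (s i < s j)%N.
Proof.
move=> irr tr tot; pose h i := #|[set k | r k i]|.
have hlt i j : r i j -> (h i < h j)%N.
  move=> rij; apply: proper_card; apply/properP; split.
    by apply/subsetP => k; rewrite !inE => /tr; apply.
  by exists i; rewrite inE ?irr.
have h_n i : (h i < n)%N.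
  rewrite -[X in (_ < X)%N]card_ord -cardsT proper_card // properT.
  by apply/eqP => /setP/(_ i); rewrite !inE irr.
have h_inj : injective (fun i => Ordinal (h_n i)).
  move=> i j [hij]; apply/eqP/contraT => /tot/orP[]/hlt; by rewrite hij ltnn.
exists (perm h_inj) => i j; rewrite !permE /=.
apply/idP/idP => [/hlt //|hij]; have [ij|/tot/orP[//|/hlt]] := eqVneq i j.
  by rewrite ij ltnn in hij.
by rewrite ltnNge ltnW.
Qed.

Lemma conjugate_band (c a b : F) A (d : 'I_n -> F) (r : rel 'I_n) :
  irreflexive r -> transitive r -> (forall i j, i != j -> r i j || r j i) ->
  (forall i, d i != 0) ->
  (forall i j, A i j =
     d i * (if i == j then c else if r i j then a else b) / d j) ->
  conjugate_mx A (band_mx n c a b).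
Proof.
move=> irr tr tot d0 AE; have [s rs] := strict_order_perm irr tr tot.
apply: (conjugate_mx_entries (s := s) d0) => i j.
by rewrite AE !mxE (inj_eq perm_inj) rs.
Qed.

End ConjugateMatrices.

(** * Explicit cycle-sums of order at most four *)

Section SmallCycleSums.
Variables (F : fieldType) (n : nat) (A : 'M[F]_n).
Implicit Types i j k l o : 'I_n.

Lemma cycle_sum1 i : cycle_sum A [set i] = A i i.
Proof.
rewrite -[[set i]]setU0 cycle_sumU1 ?path_sum0 // => x; by rewrite inE.
Qed.

Lemma cycle_sum2 i j : i != j -> cycle_sum A [set i; j] = A i j * A j i.
Proof.
have lt (k l : 'I_n) : (k < l)%N -> cycle_sum A [set k; l] = A k l * A l k.
  move=> kl; rewrite cycle_sumU1 => [|x]; last by rewrite inE => /eqP->.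
  by rewrite /path_sum ord_sum1 path_prod_cons path_prod_nil.
by case: (ltngtP i j) => [/lt //|/lt ji _|/val_inj->]; rewrite ?eqxx // setUC ji mulrC.
Qed.

Definition cycle3 i j k := A i j * A j k * A k i + A i k * A k j * A j i.

Lemma cycle_sum3 i j k : i != j -> j != k -> i != k ->
  cycle_sum A [set i; j; k] = cycle3 i j k.
Proof.
have min (u v w : 'I_n) : v != w -> (u < v)%N -> (u < w)%N ->
    cycle_sum A (u |: [set v; w]) = cycle3 u v w.
  move=> vw uv uw; rewrite cycle_sumU1 => [|x]; last by rewrite !inE => /orP[]/eqP->.
  by rewrite /path_sum ord_sum2 // !path_prod_cons !path_prod_nil !mulrA.
move=> ij jk ik; rewrite -setUA.
have [lij|lji|/val_inj eij] := ltngtP i j; last by rewrite eij eqxx in ij.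
  have [lik|lki|/val_inj eik] := ltngtP i k; last by rewrite eik eqxx in ik.
    by rewrite min.
  rewrite setUA setUC min // ?(ltn_trans lki lij) //.
  by rewrite /cycle3; ring.
rewrite setUCA.
have [ljk|lkj|/val_inj ejk] := ltngtP j k; last by rewrite ejk eqxx in jk.
  by rewrite min // /cycle3; ring.
rewrite setUA setUC min 1?eq_sym // ?(ltn_trans lkj lji) //.
by rewrite /cycle3; ring.
Qed.

Lemma cycle_sum4 o j k l : j != k -> k != l -> j != l ->
  (o < j)%N -> (o < k)%N -> (o < l)%N ->
  cycle_sum A (o |: [set j; k; l]) =
    A o j * A j k * A k l * A l o + A o j * A j l * A l k * A k o +
    (A o k * A k j * A j l * A l o + A o k * A k l * A l j * A j o) +
    (A o l * A l j * A j k * A k o + A o l * A l k * A k j * A j o).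
Proof.
move=> jk kl jl oj ok ol; rewrite cycle_sumU1 => [|x]; last first.
  by rewrite !inE -orbA => /or3P[]/eqP->.
by rewrite /path_sum ord_sum3 // !path_prod_cons !path_prod_nil !mulrA.
Qed.

End SmallCycleSums.

(** * Classification *)

Section NormalForm.
Variables (F : fieldType) (n : nat) (A : 'M[F]_n) (c a b : F) (o : 'I_n).
Hypotheses (a_neq0 : a != 0) (b_neq0 : b != 0).
Hypothesis A1 : forall i, A i i = c.
Hypothesis A2 : forall i j, i != j -> A i j * A j i = a * b.
Hypothesis A3 : forall i j k, i != j -> j != k -> i != k ->
  cycle3 A i j k = a * b * (a + b).

(* Rescaling row [o] to the constant [a] makes column [o] equal to [b]; the
   3-cycles through [o] then force each pair of opposite entries to have sum
   [a + b] and product [a * b]. *)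
Lemma normal_form : exists (d : 'I_n -> F) (E : 'M[F]_n),
  [/\ forall i, d i != 0,
      forall i j, A i j = d i * E i j / d j,
      forall i, E i i = c,
      forall j, j != o -> E o j = a /\ E j o = b &
      forall i j, i != j -> (E i j = a /\ E j i = b) \/ (E i j = b /\ E j i = a)].
Proof.
have A_neq0 i j : i != j -> A i j != 0.
  move=> /A2 Aij; have : A i j * A j i != 0 by rewrite Aij mulf_neq0.
  by rewrite mulf_eq0 negb_or => /andP[].
pose d i := if i == o then 1 else a / A o i.
have d_neq0 i : d i != 0.
  rewrite /d; have [_|io] := eqVneq i o; first exact: oner_neq0.
  by rewrite mulf_neq0 ?invr_eq0 // A_neq0 // eq_sym.
pose E := \matrix_(i, j) ((d i)^-1 * A i j * d j).
have AE i j : A i j = d i * E i j / d j.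
  by rewrite mxE; field; rewrite !d_neq0.
have Eoj j : j != o -> E o j = a /\ E j o = b.
  move=> jo; have oj : o != j by rewrite eq_sym.
  rewrite !mxE /d eqxx (negPf jo); have Aoj := A_neq0 _ _ oj.
  split; first by field; rewrite ?oner_neq0 ?Aoj.
  have -> : A j o = a * b / A o j by rewrite -(A2 oj); field.
  by field; rewrite ?a_neq0 ?Aoj.
exists d, E; split=> // [i|i j ij].
  by rewrite mxE A1; field; exact: d_neq0.
have [io|io] := eqVneq i o; first by left; rewrite io; apply: Eoj; rewrite -io eq_sym.
have [jo|jo] := eqVneq j o.
  by right; rewrite jo; have [-> ->] := Eoj _ io.
have prodE : E i j * E j i = a * b.
  by rewrite -(A2 ij) [A i j]AE [A j i]AE; field; rewrite !d_neq0.
have sumE : E i j + E j i = a + b.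
  have := A3 ij jo io; rewrite /cycle3 !AE.
  have [-> ->] := Eoj _ io; have [-> ->] := Eoj _ jo => H.
  have ab : a * b != 0 by rewrite mulf_neq0.
  apply: (mulfI ab); rewrite -H; field; rewrite !d_neq0 //.
have : (E i j - a) * (E i j - b) = 0.
  transitivity (E i j ^+ 2 - (a + b) * E i j + a * b); first by ring.
  by rewrite -sumE -prodE; ring.
move=> /eqP; rewrite mulf_eq0 !subr_eq0 => /orP[]/eqP Eij; [left|right].
  by split=> //; apply: (addrI a); rewrite -sumE Eij.
by split=> //; apply: (addrI b); rewrite [RHS]addrC -sumE Eij.
Qed.
End NormalForm.

Section Classification.
Variables (F : fieldType) (n : nat).
Implicit Types (A : 'M[F]_n) (c a b : F).

(** As [a != b], the entries equal to [a] orient every pair and form a tournament. Without cyclic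
    triangles it is transitive, hence a linear order along which the indices can be sorted. *)
Lemma conjugate_band_acyclic A c a b (d : 'I_n -> F) (E : 'M[F]_n) :
  a != b -> (forall i, d i != 0) ->
  (forall i j, A i j = d i * E i j / d j) -> (forall i, E i i = c) ->
  (forall i j, i != j -> (E i j = a /\ E j i = b) \/ (E i j = b /\ E j i = a)) ->
  (forall i j k, i != j -> j != k -> i != k ->
     E i j = a -> E j k = a -> E k i = a -> False) ->
  conjugate_mx A (band_mx n c a b).
Proof.
move=> ab d0 AE Ec Eab acyc; pose r i j := (i != j) && (E i j == a).
apply: (@conjugate_band _ _ c a b A d r) => //.
- by move=> i; rewrite /r eqxx.
- move=> j i k /andP[ij /eqP Eij] /andP[jk /eqP Ejk].
  have ik : i != k.
    apply: contraNneq ab => ik; move: jk Ejk; rewrite -ik => ji Eji.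
    by have [[_]|[]] := Eab _ _ ij; [rewrite Eji | rewrite Eij] => ->.
  rewrite /r ik; have [[-> _]|[_ Eki]] := Eab _ _ ik; first by rewrite eqxx.
  by case: (acyc i j k).
- move=> i j ij; rewrite /r ij [j == i]eq_sym ij /=.
  by have [[-> _]|[_ ->]] := Eab _ _ ij; rewrite eqxx ?orbT.
move=> i j; rewrite AE /r; have [->|ij] := eqVneq i j; first by rewrite Ec.
rewrite /=; have [[-> _]|[-> _]] := Eab _ _ ij; first by rewrite eqxx.
by rewrite eq_sym (negPf ab).
Qed.

Section SymmetrizedCycleSums.
Variable A : 'M[F]_n.
Hypothesis sA : symmetrized_cycle_sums A.
Let cs := cycle_sum_of_order A.

Lemma symmetrized_diag i : A i i = cs 1.
Proof. by rewrite -cycle_sum1 symmetrized_cycle_sumsE // cards1. Qed.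

Lemma symmetrized_pair i j : i != j -> A i j * A j i = cs 2.
Proof.
by move=> ij; rewrite -cycle_sum2 // symmetrized_cycle_sumsE // cards2 ij.
Qed.

Lemma symmetrized_triple i j k : i != j -> j != k -> i != k ->
  cycle3 A i j k = cs 3.
Proof.
move=> ij jk ik; rewrite -cycle_sum3 // symmetrized_cycle_sumsE //.
by rewrite -setUA cardsU1 cards2 !inE jk negb_or ij ik.
Qed.

End SymmetrizedCycleSums.

Lemma symmetric_classification A : (2 <= n)%N -> 2 != 0 :> F ->
  symmetrized_cycle_sums A -> symmetric_mx A ->
  exists lambda mu, conjugate_mx A (lambda *: ones_mx n + mu%:M).
Proof.
move=> n2 two sA symA; have AT i j : A j i = A i j by rewrite -{2}symA mxE.
have A1 := symmetrized_diag sA; have A2 := symmetrized_pair sA.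
set c1 := cycle_sum_of_order A 1 in A1; set c2 := cycle_sum_of_order A 2 in A2.
suff [a Aa] : exists a, conjugate_mx A (band_mx n c1 a a).
  by exists a, (c1 - a); rewrite ones_band subrK.
have [c2_0|c2_neq0] := eqVneq c2 0.
  exists 0; apply: (@conjugate_mx_diag _ _ _ _ (fun=> 1)) => [i|i j].
    exact: oner_neq0.
  rewrite mul1r divr1 mxE if_same; have [->|ij] := eqVneq i j; first exact: A1.
  by apply/eqP; rewrite -[_ == 0]orbb -mulf_eq0 -{2}AT A2 ?c2_0.
pose o : 'I_n := Ordinal (ltnW n2); pose o' : 'I_n := Ordinal n2.
(* The normal form with [a = b] needs a square root of [c2] whose sign suits the 3-cycles. *)
have [a [a2 A3]] : exists a, a * a = c2 /\
    forall i j k, i != j -> j != k -> i != k -> cycle3 A i j k = a * a * (a + a).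
  have [n3|n3] := leqP 3 n; last first.
    exists (A o o'); split; first by rewrite -{2}AT A2.
    move=> i j k; rewrite -!val_eqE /=.
    by have := ltn_ord i; have := ltn_ord j; have := ltn_ord k; lia.
  pose o2 : 'I_n := Ordinal n3.
  have := symmetrized_triple sA; set c3 := cycle_sum_of_order A 3 => A3.
  (* By symmetry both orientations of a 3-cycle give the same product, so [c3] is twice it, and its
     square involves only the entries' squares. This suggests [c3 / (2 * c2)] as the root. *)
  have c33 : c3 * c3 = 2 * 2 * (c2 * c2 * c2).
    rewrite -{1}(A3 o o' o2) // -(A3 o o' o2) // -{1}(A2 o o') // -{1}(A2 o' o2) //.
    by rewrite -(A2 o o2) // /cycle3 (AT o o') (AT o' o2) (AT o o2); ring.
  have four : 4 != 0 :> F by rewrite (natrM _ 2 2) mulf_neq0.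
  exists (c3 / (2 * c2)).
  have a2 : c3 / (2 * c2) * (c3 / (2 * c2)) = c2.
    transitivity ((c3 * c3) / (2 * 2 * c2 * c2)).
      by field; rewrite c2_neq0 two four.
    by rewrite c33; field; rewrite c2_neq0 four.
  split=> // i j k ij jk ik; rewrite a2 A3 //; field.
  by rewrite c2_neq0 two.
have a0 : a != 0 by apply: contra_neq c2_neq0 => a0; rewrite -a2 a0 mulr0.
have A2' i j : i != j -> A i j * A j i = a * a by move=> /A2->.
have [d [E [d0 AE E1 _ E2]]] := normal_form o a0 a0 A1 A2' A3.
exists a; apply: (conjugate_mx_diag d0) => i j; rewrite AE !mxE if_same.
have [->|ij] := eqVneq i j; first by rewrite E1.
by have [[-> _]|[-> _]] := E2 _ _ ij.
Qed.

(** With [b = - a] the product is [c_2] and the sum is 0, as [c_3 = 0] demands; the normal form is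
    then itself skew-symmetric. *)
Lemma skew_symmetrizable A : (3 <= n)%N ->
  symmetrized_cycle_sums A ->
  cycle_sum_of_order A 1 = 0 -> cycle_sum_of_order A 3 = 0 ->
  forall a, a != 0 -> a ^+ 2 = - cycle_sum_of_order A 2 ->
  exists B : 'M[F]_n,
    [/\ skew_symmetric_mx B, symmetrized_minors B & conjugate_mx A B].
Proof.
move=> n3 sA c1 c3 a a0 a2; pose o : 'I_n := Ordinal (leq_trans (isT : 0 < 3)%N n3).
have b0 : - a != 0 by rewrite oppr_eq0.
have [|i j ij|i j k ij jk ik|d [B [d0 AB B1 _ B2]]] := @normal_form _ n A 0 a (- a) o a0 b0.
- by move=> i; rewrite symmetrized_diag.
- by rewrite symmetrized_pair // mulrN -expr2 a2 opprK.
- by rewrite symmetrized_triple // subrr mulr0.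
exists B; split; last exact: (conjugate_mx_diag d0).
  apply/matrixP => i j; rewrite !mxE.
  have [->|ij] := eqVneq i j; first by rewrite B1 oppr0.
  by have [[-> ->]|[-> ->]] := B2 _ _ ij; rewrite ?opprK.
move=> I J IJ; rewrite -!(principal_minor_diag_conj d0 AB).
by move: IJ; apply: (symmetrized_minors_cycle_sums A).2.
Qed.

(** The constants of [lambda *: T_mx n x] as a band matrix are [lambda / x] and [- (lambda * x)].
    The two equations say that their product is [c_2] and that product times sum is [c_3]. *)
Lemma T_mx_classification A lambda x : (3 <= n)%N ->
  symmetrized_cycle_sums A -> cycle_sum_of_order A 1 = 0 ->
  lambda != 0 -> x != 0 -> lambda ^+ 2 = - cycle_sum_of_order A 2 ->
  lambda ^+ 3 * (x - x^-1) = cycle_sum_of_order A 3 ->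
  cycle_sum_of_order A 3 != 0 ->
  conjugate_mx A (lambda *: T_mx n x).
Proof.
move=> n3 sA c1 l0 x0 l2 l3 c3.
pose o : 'I_n := Ordinal (leq_trans (isT : 0 < 3)%N n3).
pose a := lambda / x; pose b := - (lambda * x).
have a0 : a != 0 by rewrite mulf_neq0 ?invr_eq0.
have b0 : b != 0 by rewrite oppr_eq0 mulf_neq0.
have ab : a * b = cycle_sum_of_order A 2.
  by rewrite -[RHS]opprK -l2 /a /b; field.
have ab3 : a * b * (a + b) = cycle_sum_of_order A 3.
  by rewrite -l3 /a /b; field.
have [|i j ij|i j k ij jk ik|d [E [d0 AE E1 _ E2]]] := @normal_form _ n A 0 a b o a0 b0.
- by move=> i; rewrite symmetrized_diag.
- by rewrite symmetrized_pair.
- by rewrite symmetrized_triple.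
have bandT : conjugate_mx (band_mx n 0 a b) (lambda *: T_mx n x).
  apply: (@conjugate_mx_diag _ _ _ _ (fun i => x ^+ i)) => [i|i j].
    exact: expf_neq0.
  rewrite [in RHS]mxE T_mx_band // !mxE /a /b.
  case: eqP => _; first by rewrite !(mulr0, mul0r).
  by case: ltnP => _; field; rewrite ?oner_neq0 ?x0 ?expf_neq0.
apply: conjugate_mx_trans bandT; have [eab|nab] := eqVneq a b.
  apply: (conjugate_mx_diag d0) => i j; rewrite AE !mxE -eab if_same.
  have [->|ij] := eqVneq i j; first by rewrite E1.
  by have [[-> _]|[-> _]] := E2 _ _ ij; rewrite -?eab.
apply: (conjugate_band_acyclic nab d0 AE E1 E2) => i j k ij jk ik Eij Ejk Eki.
have opp u v : u != v -> E u v = a -> E v u = b.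
  by move=> uv Euv; have [[]|[Euv' _]] // := E2 _ _ uv; rewrite -Euv Euv' eqxx in nab.
have := symmetrized_triple sA ij jk ik; rewrite -ab3 /cycle3 !AE.
rewrite Eij Ejk Eki (opp _ _ ij) // (opp _ _ jk) // (opp k i) // 1?eq_sym // => H.
(* A cyclic triangle has cycle-sum [a^3 + b^3] in place of [a b (a + b)]. The difference factors as
   shown, and [a + b] is nonzero because [c_3] is. *)
have : (a + b) * (a - b) ^+ 2 = 0.
  transitivity (a * a * a + b * b * b - a * b * (a + b)); first by ring.
  by rewrite -H; field; rewrite !d0.
apply/eqP/mulf_neq0; last by rewrite expf_neq0 // subr_eq0.
by apply: contra_neq c3 => s0; rewrite -ab3 s0 mulr0.
Qed.

Lemma skew_classification A a : (2 <= n)%N -> 2 != 0 :> F ->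
  symmetrized_cycle_sums A -> skew_symmetric_mx A ->
  a ^+ 2 = - cycle_sum_of_order A 2 ->
  conjugate_mx A (a *: skew_ones_mx n) \/
  (n = 4%N /\ conjugate_mx A (a *: skew_exceptional_mx n)).
Proof.
move=> n2 two sA skA a2.
have AT i j : A j i = - A i j.
  by have := congr1 (fun M : 'M_n => M i j) skA; rewrite !mxE.
have A1 i : A i i = 0.
  have : 2 * A i i = 0 by rewrite mulr_natl mulr2n {2}AT subrr.
  by move/eqP; rewrite mulf_eq0 (negPf two) => /eqP.
have aWE : a *: skew_ones_mx n = band_mx n 0 a (- a).
  rewrite skew_ones_band; apply/matrixP => i j; rewrite !mxE.
  have [_|_] := eqVneq i j; first by rewrite mulr0.
  by case: ltnP; rewrite ?mulrN mulr1.
have [a_eq0|a0] := eqVneq a 0.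
  left; apply: (@conjugate_mx_diag _ _ _ _ (fun=> 1)) => [i|i j].
    exact: oner_neq0.
  rewrite a_eq0 scale0r mxE mul1r mul0r; have [->//|ij] := eqVneq i j.
  have := symmetrized_pair sA ij; rewrite -[X in _ = X]opprK -a2 a_eq0 expr0n /=.
  by rewrite oppr0 [A j i]AT mulrN => /eqP; rewrite oppr_eq0 mulf_eq0 orbb => /eqP.
pose o : 'I_n := Ordinal (ltnW n2).
have b0 : - a != 0 by rewrite oppr_eq0.
have A2 i j : i != j -> A i j * A j i = a * - a.
  by move=> ij; rewrite symmetrized_pair // mulrN -expr2 a2 opprK.
(* The two orientations of a 3-cycle cancel by skew-symmetry. *)
have A3 i j k : i != j -> j != k -> i != k -> cycle3 A i j k = a * - a * (a + - a).
  by move=> _ _ _; rewrite /cycle3 (AT i j) (AT j k) (AT i k); ring.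
have [d [E [d0 AE E1 Eo E2]]] := normal_form o a0 b0 A1 A2 A3.
have nab : a != - a.
  by rewrite -subr_eq0 opprK -mulr2n -mulr_natl mulf_neq0.
have ET i j : E j i = - E i j.
  have [->|ij] := eqVneq i j; first by rewrite E1 oppr0.
  by have [[-> ->]|[-> ->]] := E2 _ _ ij; rewrite ?opprK.
have Eoj j : j != o -> E o j = a by move=> /Eo[].
(* Up to a constant factor, [cyc i j k] is the cycle-sum over [o], [i], [j],
   [k]: it is [3 a ^+ 2] on cyclic triples and [- a ^+ 2] on transitive ones. *)
pose cyc i j k := E i j * E j k + E j k * E k i + E k i * E i j.
have E4 i j k : i != o -> j != o -> k != o -> i != j -> j != k -> i != k ->
    - 2 * a ^+ 2 * cyc i j k = cycle_sum_of_order A 4.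
  move=> io jo ko ij jk ik.
  have lto l : l != o -> (o < l)%N by rewrite -val_eqE /= lt0n.
  have <- : cycle_sum A (o |: [set i; j; k]) = cycle_sum_of_order A 4.
    rewrite symmetrized_cycle_sumsE // -setUA !cardsU1 !inE cards1 jk.
    by rewrite !negb_or ![o == _]eq_sym io jo ko ij ik.
  rewrite (cycle_sum_diag_conj d0 AE) cycle_sum4 ?lto //.
  rewrite !(ET o) !Eoj // (ET i j) (ET j k) (ET k i) /cyc.
  ring.
have opp u v : u != v -> E u v = a -> E v u = a -> False.
  by move=> uv Euv; rewrite ET Euv => Evu; rewrite Evu eqxx in nab.
have [cycl|acyc] := boolP [exists i, exists j, exists k,
    [&& [&& i != o, j != o & k != o], [&& i != j, j != k & i != k]
      & [&& E i j == a, E j k == a & E k i == a]]]; last first.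
  (* No cyclic triangle passes through [o], since row [o] is [a] off the diagonal; so it suffices
     that none avoids [o]. *)
  left; rewrite aWE; apply: (conjugate_band_acyclic nab d0 AE E1 E2).
  move=> i j k ij jk ik Eij Ejk Eki.
  move/existsPn/(_ i)/existsPn/(_ j)/existsPn/(_ k)/negP: acyc; apply.
  rewrite ij jk ik Eij Ejk Eki eqxx !andbT.
  apply/and3P; split; apply/eqP => eo.
  - by apply: (opp i k) => //; rewrite eo Eoj // -eo eq_sym.
  - by apply: (opp j i); rewrite 1?eq_sym //; rewrite eo Eoj // -eo.
  - by apply: (opp k j); rewrite 1?eq_sym //; rewrite eo Eoj // -eo.
right; case/existsP: cycl => i /existsP[j /existsP[k]].
case/and3P=> /and3P[io jo ko] /and3P[ij jk ik] /and3P[/eqP Eij /eqP Ejk /eqP Eki].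
have four : 4 != 0 :> F by rewrite (natrM _ 2 2) mulf_neq0.
(* One cyclic triangle fixes the value of [c_4], and a transitive triple would give a different one.
   Hence all triples avoiding [o] are cyclic. *)
have cycE p q r : p != o -> q != o -> r != o -> p != q -> q != r -> p != r ->
    E p q = a -> E q r = a /\ E r p = a.
  move=> po qo ro pq qr pr Epq.
  have cyc3 : cyc p q r = 3 * a ^+ 2.
    have nz : - 2 * a ^+ 2 != 0 by rewrite mulf_neq0 ?oppr_eq0 ?expf_neq0.
    apply: (mulfI nz); rewrite E4 // -(E4 i j k) //.
    by rewrite /cyc Eij Ejk Eki; ring.
  have bad : cyc p q r = - a ^+ 2 -> False.
    rewrite cyc3 => H; have : 4 * a ^+ 2 = 0.
      by transitivity (3 * a ^+ 2 - - a ^+ 2); [ring | rewrite H subrr].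
    by apply/eqP; rewrite mulf_neq0 ?expf_neq0.
  have rp : r != p by rewrite eq_sym.
  have [[Eqr _]|[Eqr _]] := E2 _ _ qr; have [[Erp _]|[Erp _]] := E2 _ _ rp => //;
    by case: bad; rewrite /cyc Epq Eqr Erp; ring.
(* A fifth index [l] would receive an arc from [j] by the triple [i], [j], [l] and send one to [j]
   by the triple [j], [k], [l]. *)
have all4 l : l \in [set o; i; j; k].
  rewrite !inE; apply/contraT; rewrite !negb_or -!andbA => /and4P[lo li lj lk].
  have jl : j != l by rewrite eq_sym.
  have il : i != l by rewrite eq_sym.
  have kl : k != l by rewrite eq_sym.
  have [Ejl _] := cycE i j l io jo lo ij jl il Eij.
  have [_ Elj] := cycE j k l jo ko lo jk kl jl Ejk.
  by case: (opp j l).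
have n4 : n = 4%N.
  have <- : #|[set o; i; j; k]| = 4%N.
    rewrite -!setUA !cardsU1 !inE cards1 jk !negb_or ij ik.
    by rewrite ![o == _]eq_sym io jo ko.
  by rewrite -[LHS]card_ord; apply: eq_card => l; rewrite all4.
split=> //.
(* In the order [o], [i], [j], [k] the entries are those of the exceptional matrix. *)
pose f x : nat := if x == o then 0 else if x == i then 1 else if x == j then 2 else 3.
have f_n x : (f x < n)%N by rewrite n4 /f; do 3?case: ifP => _.
have f_o : f o = 0%N by rewrite /f eqxx.
have f_i : f i = 1%N by rewrite /f (negPf io) eqxx.
have f_j : f j = 2%N by rewrite /f (negPf jo) eq_sym (negPf ij) eqxx.
have f_k : f k = 3%N.
  by rewrite /f (negPf ko) eq_sym (negPf ik) eq_sym (negPf jk).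
have f_inj : injective (fun x => Ordinal (f_n x)).
  move=> x y [] /eqP; move: (all4 x) (all4 y); rewrite !inE -!orbA.
  by do 2![case/or4P=> /eqP->]; rewrite ?f_o ?f_i ?f_j ?f_k.
apply: (@conjugate_mx_entries _ _ _ _ d (perm f_inj) d0) => x y.
rewrite AE; congr (_ * _ / _); rewrite !mxE !permE /=.
move: (all4 x) (all4 y); rewrite !inE -!orbA.
by do 2![case/or4P=> /eqP->]; rewrite ?f_o ?f_i ?f_j ?f_k /=
  ?mulr0 ?mulr1 ?mulrN1 ?E1 ?Eij ?Ejk ?Eki ?(ET o) ?Eoj //
  ?(ET i j) ?(ET j k) ?(ET k i) ?Eij ?Ejk ?Eki ?opprK.
Qed.

End Classification.

(** * Shortest cycles of a digraph are chordless *)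

Section ShortestCycle.
Variables (T : eqType) (r : rel T) (k : nat).
Hypothesis min_k : forall q, q != [::] -> path.cycle r q -> (k <= size q)%N.
Variable p : seq T.
Hypotheses (rp : path.cycle r p) (sz_p : size p = k).

Let rot_cycle_to y : y \in p ->
  exists i q, [/\ rot i p = y :: q, path r y (rcons q y) & (size q).+1 = k].
Proof.
move=> /rot_to[i q def_q]; exists i, q.
split=> //; last by rewrite -sz_p -(size_rot i p) def_q.
by have := rp; rewrite -(rot_cycle i r p) def_q.
Qed.

(** The stretch between two visits to the same vertex would be a shorter cycle. *)
Lemma shortest_cycle_uniq : uniq p.
Proof.
apply: count_mem_uniq => y; case: (boolP (y \in p)) => [yp|/count_memPn-> //].
have [i [q [def_q rq szq]]] := rot_cycle_to yp.
have /seq.permP-> : perm_eq p (y :: q) by rewrite -def_q perm_sym perm_rot.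
rewrite /= eqxx; suff /count_memPn-> : y \notin q by [].
apply/negP => /splitPr def2; case: def2 rq szq {def_q} => q1 q2.
rewrite rcons_cat cat_path /= => /and3P[rq1 ry _].
have := min_k (q := y :: q1) isT; rewrite /= rcons_path rq1 ry => /(_ isT).
by rewrite size_cat /=; lia.
Qed.

(* A chord would close up a shorter cycle. *)
Lemma shortest_cycle_next x y : x \in p -> y \in p -> r x y -> next p x = y.
Proof.
move=> xp yp rxy; have Up := shortest_cycle_uniq.
have [i [q [def_q rq szq]]] := rot_cycle_to yp.
rewrite -(next_rot i Up) def_q.
have Uq : uniq (y :: q) by rewrite -def_q rot_uniq.
have xq : x \in y :: q by rewrite -def_q mem_rot.
suff -> : x = last y q.
  by have := cycle_next Uq; rewrite /= rcons_path => /andP[_ /eqP].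
case/splitPl: xq rq szq {def_q Uq} => q1 q2 defx.
rewrite rcons_cat cat_path => /andP[rq1 _]; rewrite size_cat last_cat defx.
have := min_k (q := y :: q1) isT; rewrite /= rcons_path rq1 defx rxy => /(_ isT).
by case: q2 => //= z q2; lia.
Qed.

End ShortestCycle.

(** * Matrices with vanishing cycle-sums of orders one and two *)

Section Nilpotent.
Variables (F : fieldType) (n : nat) (A : 'M[F]_n).
Implicit Types (I J : {set 'I_n}) (p q : seq 'I_n).

Let r : rel 'I_n := [rel i j | A i j != 0].

Lemma path_prod_neq0 u v p : (path_prod A u v p != 0) = path r u (rcons p v).
Proof.
elim: p u => [|j p IH] u; first by rewrite path_prod_nil /= andbT.
by rewrite path_prod_cons mulf_eq0 negb_or IH.
Qed.

Lemma cycle_of_cycle_sum I : I != set0 -> cycle_sum A I != 0 ->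
  exists q, path.cycle r q /\ perm_eq q (enum I).
Proof.
move=> /set_minP[u [S -> uS]]; rewrite cycle_sumU1 // => nz.
have [/hasP[p pS]|/hasPn none] :=
  boolP (has (fun p => path_prod A u u p != 0) (permutations (enum S))).
  rewrite path_prod_neq0 mem_permutations in pS * => rp.
  by exists (u :: p); rewrite enum_setU1_min // perm_cons.
case/eqP: nz; rewrite /path_sum /ord_sum big1_seq // => p /none.
by rewrite negbK => /eqP.
Qed.

(** All arcs among the vertices of [p] follow [next p], so exactly one ordering has a nonzero
    product and nothing can cancel it. *)
Lemma cycle_sum_shortest_cycle k p :
  (forall q, q != [::] -> path.cycle r q -> (k <= size q)%N) ->
  path.cycle r p -> size p = k -> p != [::] -> cycle_sum A [set i in p] != 0.
Proof.
move=> min_k rp szp p_n0; have Up := shortest_cycle_uniq min_k rp szp.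
have nextp := shortest_cycle_next min_k rp szp.
have In0 : [set i in p] != set0.
  case: p p_n0 {rp szp Up nextp} => // x p _.
  by apply/set0Pn; exists x; rewrite !inE eqxx.
have [u [S defI uS]] := set_minP In0; rewrite defI cycle_sumU1 //.
have up : u \in p by have := setU11 u S; rewrite -defI inE.
have uS' : u \notin S by apply/negP => /uS; rewrite ltnn.
have [i t def_t] := rot_to up.
have Ut : uniq (u :: t) by rewrite -def_t rot_uniq.
have mem_t x : (x \in u :: t) = (x \in u |: S) by rewrite -def_t mem_rot -defI inE.
have tS : perm_eq t (enum S).
  rewrite -(perm_cons u) -enum_setU1_min //; apply: uniq_perm => //.
    exact: enum_uniq.
  by move=> x; rewrite mem_t mem_enum.
have rt : path.cycle r (u :: t) by rewrite -def_t rot_cycle.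
rewrite /path_sum /ord_sum (bigD1_seq t) ?permutations_uniq ?mem_permutations //=.
rewrite big1_seq ?addr0 ?path_prod_neq0 // => t' /andP[t't].
rewrite mem_permutations => t'S; apply/eqP; apply: contraNT t't.
have fp q : perm_eq q (enum S) -> path r u (rcons q u) ->
    q = traject (next p) (next p u) (size q).
  move=> qS; rewrite rcons_path => /andP[rq _]; apply: fpathE.
  apply: (sub_in_path (P := mem p)) rq => [x y xp yp rxy|].
    by apply/eqP; apply: nextp.
  apply/allP => x; rewrite inE => xq; change (x \in p).
  have -> : (x \in p) = (x \in u |: S) by rewrite -defI inE.
  by move: xq; rewrite !inE (perm_mem qS) mem_enum.
rewrite path_prod_neq0 => rt'; rewrite (fp _ tS rt) (fp _ t'S rt').
by rewrite (perm_size tS) (perm_size t'S).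
Qed.

(** Along an arc the set of reachable vertices shrinks strictly, because the source cannot be
    reached again. Sorting by decreasing size of this set, with ties broken by index, makes all arcs
    go upward. *)
Lemma acyclic_strictly_upper :
  (forall q, q != [::] -> ~~ path.cycle r q) ->
  exists2 B : 'M[F]_n, strictly_upper_triangular B & conjugate_mx A B.
Proof.
move=> acyc; pose h i := #|connect r i|.
have h_lt i j : r i j -> (h j < h i)%N.
  move=> rij; apply/proper_card/properP; split.
    by apply/subsetP => x; apply: connect_trans; apply: connect1.
  exists i; first exact: connect0.
  apply/negP => /connectP[q rq lq]; have /negP := acyc (j :: q) isT; apply.
  by rewrite /= rcons_path rq -lq.
pose lt i j := (h j < h i)%N || (h i == h j) && (i < j)%N.
have [|||s ltE] := @strict_order_perm n lt.
- by move=> i; rewrite /lt !ltnn andbF.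
- by move=> j i k; rewrite /lt; lia.
- by move=> i j; rewrite -val_eqE /lt /=; lia.
exists (\matrix_(i, j) A ((s^-1)%g i) ((s^-1)%g j)).
  move=> i j ji; rewrite mxE; apply/eqP/negPn/negP => rij.
  have := ltE ((s^-1)%g i) ((s^-1)%g j).
  by rewrite !permKV /lt (h_lt _ _ rij) /= => /esym; rewrite ltnNge ji.
apply: (@conjugate_mx_entries _ _ _ _ (fun=> 1) s) => [i|i j].
  exact: oner_neq0.
by rewrite mxE !permK mul1r divr1.
Qed.

Lemma nilpotent_classification : (0 < n)%N ->
  symmetrized_cycle_sums A ->
  cycle_sum_of_order A 1 = 0 -> cycle_sum_of_order A 2 = 0 ->
  ((exists2 B : 'M[F]_n, strictly_upper_triangular B & conjugate_mx A B) /\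
   (forall k : nat, (1 <= k <= n)%N -> cycle_sum_of_order A k = 0)) \/
  [/\ (exists2 B : 'M[F]_n, weighted_cycle_mx B & conjugate_mx A B),
      (forall k : nat, (1 <= k < n)%N -> cycle_sum_of_order A k = 0) &
      cycle_sum_of_order A n != 0].
Proof.
move=> n0 sA c1 c2.
have no_short k : (0 < k <= n)%N -> cycle_sum_of_order A k != 0 ->
    exists2 q, path.cycle r q & size q = k.
  move=> /andP[k0 kn]; have cI := card_initial_set kn.
  case/cycle_of_cycle_sum=> [|q [rq q_perm]]; first by rewrite -card_gt0 cI.
  by exists q; rewrite // (perm_size q_perm) -cardE.
pose P k := (0 < k)%N && [exists q : k.-tuple 'I_n, path.cycle r q].
have PE q : q != [::] -> path.cycle r q -> P (size q).
  move=> q0 rq; rewrite /P lt0n size_eq0 q0; apply/existsP.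
  by exists (in_tuple q).
have shortest q : q != [::] -> path.cycle r q -> exists p,
    [/\ p != [::], path.cycle r p &
        forall q', q' != [::] -> path.cycle r q' -> (size p <= size q')%N].
  move=> q0 rq; have exP : exists k, P k by exists (size q); apply: PE.
  case: (ex_minnP exP) => k /andP[k0 /existsP[p rp]] min_k.
  exists p; rewrite -size_eq0 size_tuple -lt0n; split=> // q' q'0 rq'.
  exact/min_k/PE.
(* Lengths up to [n] suffice to detect a cycle, since a shortest one has distinct vertices. *)
have [/existsP[k Pk]|/existsPn acyc] := boolP [exists k : 'I_n.+1, P k]; last first.
  left; split.
    apply: acyclic_strictly_upper => q q0; apply/negP => rq.
    have [p [p0 rp min_p]] := shortest q q0 rq.
    have /card_uniqP Up := shortest_cycle_uniq min_p rp erefl.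
    have pn : (size p < n.+1)%N by rewrite ltnS -Up -[X in (_ <= X)%N]card_ord max_card.
    by have /negP := acyc (Ordinal pn); apply; apply: PE.
  move=> k kn; apply/eqP/negPn/negP => /(no_short _ kn)[q rq szq].
  have k_n : (k < n.+1)%N by case/andP: kn.
  have /negP := acyc (Ordinal k_n); apply; rewrite /= -szq; apply: PE => //.
  by rewrite -size_eq0 szq -lt0n; case/andP: kn.
right.
have [p [p0 rp min_p]] : exists p, [/\ p != [::], path.cycle r p &
    forall q, q != [::] -> path.cycle r q -> (size p <= size q)%N].
  case/andP: Pk => k0 /existsP[q rq]; apply: shortest rq.
  by rewrite -size_eq0 size_tuple -lt0n.
have Up := shortest_cycle_uniq min_p rp erefl.
have nextp := shortest_cycle_next min_p rp erefl.
have Inz := cycle_sum_shortest_cycle min_p rp erefl p0.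
set I := [set i in p] in Inz.
have memI x : (x \in I) = (x \in p) by rewrite inE.
have cI : #|I| = size p by rewrite cardsE (card_uniqP Up).
have pn : (size p <= n)%N by rewrite -cI -[X in (_ <= X)%N]card_ord max_card.
have no_loop i : ~~ r i i by rewrite /r /= (symmetrized_diag sA) c1 eqxx.
have no_pair i j : r i j -> ~~ r j i.
  move=> rij; have ij : i != j by apply: contraTneq rij => ->.
  apply/negP => rji; have /eqP := symmetrized_pair sA ij.
  by rewrite c2; apply/negP; rewrite mulf_neq0.
have size_p : size p = n.
  apply/eqP; rewrite eqn_leq pn leqNgt; apply/negP => lt_pn.
  have [v vI] : exists v, v \notin I.
    apply/existsP; rewrite -negb_forall; apply/negP => /forallP allI.
    move: lt_pn; rewrite -cI ltnNge => /negP; apply.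
    by rewrite -[X in (X <= _)%N]card_ord; apply/subset_leq_card/subsetP => x _.
  (* Trading a vertex of the shortest cycle for [v] must leave a cycle, so [v]
     has an arc to and an arc from every vertex of it. *)
  have swap i : i \in I -> exists q, path.cycle r q /\ (q =i v |: (I :\ i)).
    move=> iI; pose J := v |: (I :\ i).
    have cJ : #|J| = #|I|.
      by rewrite cardsU1 in_setD1 negb_and vI orbT (cardsD1 i I) iI.
    have [||q [rq qJ]] := @cycle_of_cycle_sum J.
    - by apply/set0Pn; exists v; rewrite setU11.
    - by rewrite (sA J I cJ).
    by exists q; split=> // x; rewrite (perm_mem qJ) mem_enum.
  have [y yp] : exists y, y \in p.
    by case: (p) p0 => // y q _; exists y; rewrite mem_head.
  have r_vy : r v y.
    have [|q [rq qJ]] := swap (prev p y); first by rewrite memI mem_prev.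
    have yq : y \in q.
      rewrite qJ !inE yp andbT; apply/orP; right.
      by apply: contraNneq (no_loop y) => {1}->; apply: prev_cycle.
    (* The predecessor of [y] on the new cycle is [v] or a vertex of [p]. In the latter case
       chordlessness makes it [prev p y], the vertex that was removed. *)
    have rzy := prev_cycle rq yq; move: (mem_prev q y); rewrite yq qJ !inE.
    case/orP=> [/eqP <- //|/andP[/negP zy zp]]; case: zy; apply/eqP.
    by rewrite -{2}(nextp _ _ zp yp rzy) (prev_next Up).
  have r_yv : r y v.
    have [|q [rq qJ]] := swap (next p y); first by rewrite memI mem_next.
    have yq : y \in q.
      rewrite qJ !inE yp andbT; apply/orP; right.
      by apply: contraNneq (no_loop y) => {2}->; apply: next_cycle.
    have ryz := next_cycle rq yq; move: (mem_next q y); rewrite yq qJ !inE.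
    case/orP=> [/eqP <- //|/andP[/negP zy zp]]; case: zy; apply/eqP.
    by rewrite (nextp _ _ yp zp ryz).
  by have := no_pair _ _ r_vy; rewrite r_yv.
split.
- have allp x : x \in p.
    rewrite -memI; have -> : I = setT; last by rewrite inE.
    by apply/eqP; rewrite eqEcard subsetT cardsT card_ord cI size_p leqnn.
  exists A; last by apply: conjugate_mx_refl.
  have next_inj := can_inj (prev_next Up).
  (* The cycle passes through all indices, so by chordlessness [A] itself has no nonzero entry
     outside the positions of [next p]. *)
  exists (\row_i A i (next p i)), (perm next_inj); split.
  + rewrite unitmxE det_diag unitfE; apply/prodf_neq0 => i _.
    by rewrite mxE; apply: (next_cycle rp).
  + move=> i; apply/setP => j; rewrite inE; apply/porbitP.
    exists (findex (next p) i j); rewrite permX.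
    rewrite (eq_iter (permE next_inj)) iter_findex //.
    by rewrite (fconnect_cycle (cycle_next Up)).
  apply/matrixP => i j; rewrite mul_diag_mx !mxE permE.
  have [->|ij] := eqVneq (next p i) j; first by rewrite mulr1.
  rewrite mulr0; apply/eqP/negPn; apply: contra ij => rij.
  exact/eqP/nextp.
- move=> j /andP[j0 jn]; apply/eqP/negPn/negP => /no_short[|q rq szq].
    by rewrite j0 ltnW.
  have := min_p q; rewrite rq size_p szq leqNgt jn => H; suff: false by [].
  by apply: H; rewrite // -size_eq0 szq -lt0n.
have := Inz; rewrite symmetrized_cycle_sumsE // cI.
by congr (is_true (cycle_sum_of_order A _ != 0)).
Qed.

End Nilpotent.

Theorem theorem1p1 (R : realType) (n : nat) (hn : (2 <= n)%N)
    (A : 'M[R[i]]_n) :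
  let c := cycle_sum_of_order A in
  (symmetrized_minors A <-> symmetrized_cycle_sums A) /\
  (symmetrized_minors A ->
  [/\ (symmetric_mx A ->
         exists lambda mu : R[i],
           conjugate_mx A (lambda *: ones_mx n + mu%:M)) /\
      (forall lambda mu : R[i],
         let M : 'M[R[i]]_n := lambda *: ones_mx n + mu%:M in
         [/\ symmetrized_minors M,
             symmetrized_cycle_sums M,
             (forall k : nat, (1 <= k <= n)%N ->
                minor_of_order M k = mu ^+ k.-1 * (mu + k%:R * lambda)) &
             (forall k : nat, (2 <= k <= n)%N ->
                cycle_sum_of_order M k = (k.-1)`!%:R * lambda ^+ k)]),
      (skew_symmetric_mx A ->
         exists lambda : R[i],
           conjugate_mx A (lambda *: skew_ones_mx n) \/
           (n = 4%N /\ conjugate_mx A (lambda *: skew_exceptional_mx n))) /\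
      let W : 'M[R[i]]_n := skew_ones_mx n in
      [/\ symmetrized_minors W,
          symmetrized_cycle_sums W &
          forall k : nat, (2 <= k <= n)%N -> ~~ odd k ->
            minor_of_order W k = 1 /\
            cycle_sum_of_order W k = (-1) ^+ k./2 * (euler_number k.-1)%:R],
      ((3 <= n)%N -> c 1%N = 0 -> c 2%N = 0 ->
         ((exists2 B : 'M[R[i]]_n,
             strictly_upper_triangular B & conjugate_mx A B) /\
          (forall k : nat, (1 <= k <= n)%N -> c k = 0)) \/
         [/\ (exists2 B : 'M[R[i]]_n, weighted_cycle_mx B & conjugate_mx A B),
             (forall k : nat, (1 <= k < n)%N -> c k = 0) &
             c n != 0]),
      ((3 <= n)%N -> c 2%N != 0 -> c 1%N = 0 -> c 3%N = 0 ->
         exists B : 'M[R[i]]_n,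
           [/\ skew_symmetric_mx B, symmetrized_minors B & conjugate_mx A B]) &
      ((3 <= n)%N -> c 1%N = 0 -> c 2%N * c 3%N != 0 ->
         exists lambda x : R[i],
           [/\ x != 0,
               conjugate_mx A (lambda *: T_mx n x),
               lambda ^+ 2 = - c 2%N &
               lambda ^+ 3 * (x - x^-1) = c 3%N]) /\
      (forall x : R[i], x != 0 ->
         [/\ symmetrized_minors (T_mx n x),
             symmetrized_cycle_sums (T_mx n x),
             symmetrized_minors (x *: T_mx n x) &
             forall s : nat, (2 <= s <= n)%N ->
               [/\ cycle_sum_of_order (T_mx n x) s =
                     x ^- s * (eulerian_poly s.-1).[- x ^+ 2],
                   (x ^+ 2 != - 1 ->
                      minor_of_order (T_mx n x) s =
                        ((x ^+ 2) ^+ s.-1 + (-1) ^+ s) /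
                        (x ^+ (s - 2) * (x ^+ 2 + 1))) &
                   (x ^+ 2 + 1) * minor_of_order (x *: T_mx n x) s =
                     x ^+ (2 * s) + (-1) ^+ s * x ^+ 2]])]).
Proof.
have two : 2 != 0 :> R[i] by rewrite pnatr_eq0.
move=> c; split; first exact: symmetrized_minors_cycle_sums.
move=> mA; have sA := (symmetrized_minors_cycle_sums A).1 mA.
split.
- split; first exact: symmetric_classification.
  move=> lambda mu M.
  have mM : symmetrized_minors M.
    by rewrite /M ones_band; exact: band_symmetrized_minors.
  split=> //; first exact/symmetrized_minors_cycle_sums.
    by move=> k kn; rewrite minor_of_order_ones.
  by move=> k kn; rewrite cycle_sum_ones.
- split.
    move=> skA; exists (sqrtC (- cycle_sum_of_order A 2)).
    by apply: skew_classification; rewrite // sqrtCK.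
  move=> W.
  have mW : symmetrized_minors W.
    by rewrite /W skew_ones_band; exact: band_symmetrized_minors.
  split=> //; first exact/symmetrized_minors_cycle_sums.
  move=> k /andP[k2 kn] even_k; split; last by rewrite cycle_sum_skew_ones ?k2.
  by rewrite /W skew_ones_band minor_of_order_band // det_skew_ones // even_k.
- by move=> n3 c1 c2; apply: nilpotent_classification => //; apply: ltnW.
- move=> n3 c2 c1 c3; apply: (skew_symmetrizable n3 sA c1 c3 (a := sqrtC (- c 2%N))).
    by rewrite sqrtC_eq0 oppr_eq0.
  exact: sqrtCK.
split.
  move=> n3 c1; rewrite mulf_eq0 negb_or => /andP[c2 c3].
  pose lambda := sqrtC (- c 2%N).
  have l2 : lambda ^+ 2 = - c 2%N by rewrite sqrtCK.
  have l0 : lambda != 0 by rewrite sqrtC_eq0 oppr_eq0.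
  (* [x] is a root of [x^2 - h x - 1], so that [x - x^-1 = h]. *)
  pose h := c 3%N / lambda ^+ 3; pose x := (h + sqrtC (h ^+ 2 + 4)) / 2.
  have xh : x * (x - h) = 1.
    transitivity ((sqrtC (h ^+ 2 + 4) ^+ 2 - h ^+ 2) / 4).
      by rewrite /x; field.
    by rewrite sqrtCK; field.
  have x0 : x != 0 by apply: contra_eq_neq xh => ->; rewrite mul0r eq_sym oner_eq0.
  have l3 : lambda ^+ 3 * (x - x^-1) = c 3%N.
    have -> : x^-1 = x - h by apply: (mulfI x0); rewrite xh mulfV.
    by rewrite /h; field.
  by exists lambda, x; split=> //; apply: T_mx_classification.
move=> x x0; have mT := @T_mx_symmetrized_minors _ n x x0; split=> //.
- exact/symmetrized_minors_cycle_sums.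
- exact: scaled_T_mx_symmetrized_minors.
move=> s sn; split; first exact: cycle_sum_T_mx.
- exact: minor_of_order_T_mx.
- exact: minor_of_order_scaled_T_mx.
Qed.
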